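(* Let $\mathcal{C}$ be a premodular category over $\mathbb{C}$ with ribbon structure $\theta$ and braiding $R$, and let $\operatorname{Irr}(\mathcal{C})$ be a complete set of pairwise non-isomorphic simple objects of $\mathcal{C}$ containing the unit object. Fix a total order on $\operatorname{Irr}(\mathcal{C})$ and, for each $c\in\operatorname{Irr}(\mathcal{C})$, an arbitrary square root $\sqrt{\theta_c}$ of $\theta_c$. (1) For all $a,c\in\operatorname{Irr}(\mathcal{C})$, the number $\frac{1}{\sqrt{\theta_c}}\,\nu_{2,1}^{\iota(c)}(a)$ is an integer, it satisfies $\left|\frac{1}{\sqrt{\theta_c}}\,\nu_{2,1}^{\iota(c)}(a)\right|\le N_c^{a,a}$, and it has the same parity as $N_c^{a,a}$. (2) The braiding of $\mathcal{C}$ is completely determined by the fusion rules, the ribbon structure and the generalized Frobenius-Schur indicators $\nu_{2,1}^{\iota(c)}(a)$ ($a,c\in\operatorname{Irr}(\mathcal{C})$), in the following sense: there exists a gauge choice $B=\{B^{a,b}_c\mid a,b,c\in\operatorname{Irr}(\mathcal{C})\}$ of $\mathcal{C}$ such that, for all $a,b,c\in\operatorname{Irr}(\mathcal{C})$, the matrix $[R_{a,b}^c]$ of $R_{a,b}^c:\mathcal{C}(b\otimes a,c)\to\mathcal{C}(a\otimes b,c)$ relative to the bases $B^{b,a}_c$ and $B^{a,b}_c$ is $$ [R_{a,b}^c]=\operatorname{id}\ \text{ if } a>b,\qquad [R_{a,b}^c]=\frac{\theta_c}{\theta_a\theta_b}\operatorname{id}\ \text{ if } a<b, $$ $$ [R_{a,a}^c]=\frac{\sqrt{\theta_c}}{\theta_a}\begin{pmatrix}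 I_{d_+}&0\\ 0&-I_{d_-}\end{pmatrix}\ \text{ if } a=b, $$ where $I_d$ is the $d\times d$ identity matrix and the nonnegative integers $d_\pm$ (depending on $a,c$) are $$ d_{\pm}=\frac12\left(N_c^{a,a}\pm\frac{1}{\sqrt{\theta_c}}\,\nu_{2,1}^{\iota(c)}(a)\right). $$ (3) In particular, if $\mathcal{C}$ is modular, the braiding of $\mathcal{C}$ is completely determined, in the same sense, by the modular data $(S,T)$ of $\mathcal{C}$ (the fusion rules being determined by $S$), and the integers $d_\pm$ in (2) are given by $$ d_{\pm}=\frac12\left(N_c^{a,a}\pm\frac{1}{\sqrt{\theta_c}\,\dim\mathcal{C}}\sum_{k,l\in\operatorname{Irr}(\mathcal{C})} d_k\,\overline{S}_{c,l}\,N^{k,l}_a\,\frac{\theta_k^2}{\theta_l^2}\right), $$ where $d_k$ is the categorical dimension of $k$.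
   Context: A premodular category over $\mathbb{C}$ is a ribbon fusion category over $\mathbb{C}$, i.e. a braided fusion category over $\mathbb{C}$ with a ribbon structure; without loss of generality it is taken to be strict pivotal, with the (spherical) pivotal structure associated with the ribbon structure. The braiding is $R_{x,y}:x\otimes y\to y\otimes x$. The ribbon structure $\theta$ is a natural isomorphism of the identity functor with $(\theta_x)^*=\theta_{x^*}$ and $\theta_{x\otimes y}=(\theta_x\otimes\theta_y)\circ R_{y,x}\circ R_{x,y}$. For $a\in\operatorname{Irr}(\mathcal{C})$ the scalar by which $\theta_a$ acts on $a$ is also denoted $\theta_a$. $\mathcal{C}(x,y)$ denotes the space of morphisms from $x$ to $y$, and $N_c^{a,b}=\dim_{\mathbb{C}}\mathcal{C}(a\otimes b,c)$ for $a,b,c\in\operatorname{Irr}(\mathcal{C})$ are the fusion coefficients (fusion rules). A gauge choice of $\mathcal{C}$ is a collection $B=\{B^{a,b}_c\}$ where $B^{a,b}_c$ is an (ordered) basis of $\mathcal{C}(a\otimes b,c)$. The linear isomorphism $R_{a,b}^c:\mathcal{C}(b\otimes a,c)\to\mathcal{C}(a\otimes b,c)$ is $R_{a,b}^c(\pi)=\pi\circ R_{a,b}$. Center and embedding. Objects of the Drinfeld center $Z(\mathcal{C})$ are pairs $(x,\sigma_{x,-})$ with $x\in\mathcal{C}$ and $\sigma_{x,y}:x\otimes y\to y\otimes x$ a half-braiding, natural in $y\in\mathcal{C}$. The embedding $\iota:\mathcal{C}\to Z(\mathcal{C})$ is $\iota(x)=(x,R^{-1}_{-,x})$, i.e. $\sigma_{x,y}=R_{y,x}^{-1}$.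 Generalized Frobenius-Schur indicators. Let $\mathcal{D}$ be a strict spherical fusion category (strict pivotal, so $z^{**}=z$), $\mathbf{X}=(x,\sigma_{x,-})\in Z(\mathcal{D})$ and $z\in\mathcal{D}$. Write $\operatorname{ev}_z:z^*\otimes z\to\mathbb{1}$ and $\operatorname{coev}_{z^*}:\mathbb{1}\to z^*\otimes z^{**}=z^*\otimes z$ for evaluation and coevaluation. Define the linear operator $E^{(2,1)}_{\mathbf{X},z}:\mathcal{D}(x,z\otimes z)\to\mathcal{D}(x,z\otimes z)$ by $$E^{(2,1)}_{\mathbf{X},z}(f)=(\operatorname{ev}_z\otimes\operatorname{id}_{z\otimes z})\circ(\operatorname{id}_{z^*}\otimes f\otimes\operatorname{id}_z)\circ(\sigma_{x,z^*}\otimes\operatorname{id}_z)\circ(\operatorname{id}_x\otimes\operatorname{coev}_{z^*}).$$ (That is, the first leg $z$ is rotated to the other side of the second leg using the half-braiding.) The indicator is $\nu_{2,1}^{\mathbf{X}}(z)=\operatorname{Tr}(E^{(2,1)}_{\mathbf{X},z})$. In the claim, $\mathcal{D}=\mathcal{C}$, $\mathbf{X}=\iota(c)$, $z=a$. Modular data. $d_k$ is the categorical (pivotal) dimension of $k$, and $\dim\mathcal{C}=\sum_{k\in\operatorname{Irr}(\mathcal{C})}d_k^2$. The $S$-matrix is the unnormalized one, $S_{i,j}=\theta_i^{-1}\theta_j^{-1}\sum_{k\in\operatorname{Irr}(\mathcal{C})}N_k^{i^*,j}\theta_k d_k$ (the categorical trace of the double braiding $R_{j,i^*}\circ R_{i^*,j}$;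 here $i^*$ denotes the simple object in $\operatorname{Irr}(\mathcal{C})$ isomorphic to the dual of $i$), the $T$-matrix is $T_{i,j}=\delta_{i,j}\theta_i$, and $\overline{S}$ is the entrywise complex conjugate of $S$. $\mathcal{C}$ is modular if $S$ is invertible. *)

(* Defs.v *)
From HB Require Import structures.
From mathcomp Require Import all_boot all_order all_algebra.
From mathcomp Require Import boolp reals complex.

Set Implicit Arguments.
Unset Strict Implicit.
Unset Printing Implicit Defensive.

Import Order.TTheory GRing.Theory Num.Theory.
Local Open Scope ring_scope.

Declare Scope cat_scope.
Delimit Scope cat_scope with cat.
Local Open Scope cat_scope.

(* Column convention, unlike mathcomp's mxof: column j holds the coordinates  *)
(* of f e_j.                                                                  *)
Definition mx_of (K : fieldType) (U V : vectType K) (m n : nat)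
    (e : n.-tuple U) (e' : m.-tuple V) (f : U -> V) : 'M[K]_(m, n) :=
  \matrix_(i, j) coord e' i (f e`_j).

Definition trace_of (K : fieldType) (V : vectType K) (f : V -> V) : K :=
  \tr (mx_of (vbasis {:V}) (vbasis {:V}) f).

(* Equality of matrices whose dimensions agree only propositionally.          *)
Definition eqmx_cast (X : Type) (m n m' n' : nat)
    (A : 'M[X]_(m, n)) (B : 'M[X]_(m', n')) : Prop :=
  exists e : (m = m') * (n = n'), castmx e A = B.

Record lincat (K : fieldType) := LinCat {
  obj :> Type;
  hom : obj -> obj -> vectType K;
  idm : forall x, hom x x;
  compm : forall {x y z}, hom y z -> hom x y -> hom x z;
  compm_idl : forall x y (f : hom x y), compm (idm y) f = f;
  compm_idr : forall x y (f : hom x y), compm f (idm x) = f;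
  compmA : forall w x y z (h : hom y z) (g : hom x y) (f : hom w x),
    compm h (compm g f) = compm (compm h g) f;
  compm_linear_l : forall x y z (f : hom x y),
    linear (fun g : hom y z => compm g f);
  compm_linear_r : forall x y z (g : hom y z),
    linear (fun f : hom x y => compm g f)
}.
Arguments hom {K l} x y.
Arguments idm {K l} x.
Arguments compm {K l x y z} g f : rename.

Notation "g ∘ f" := (compm g f) (at level 40, left associativity) : cat_scope.

Section Abelian.
Variables (K : fieldType) (C : lincat K).
Implicit Types x y z : C.

Definition mutually_inverse x y (f : hom x y) (g : hom y x) : Prop :=
  g ∘ f = idm x /\ f ∘ g = idm y.
Definition is_iso x y (f : hom x y) : Prop := exists g, mutually_inverse f g.
Definition isomorphic x y : Prop := exists f : hom x y, is_iso f.

Definition is_mono x y (f : hom x y) : Prop :=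
  forall w (g h : hom w x), f ∘ g = f ∘ h -> g = h.
Definition is_epi x y (f : hom x y) : Prop :=
  forall z (g h : hom y z), g ∘ f = h ∘ f -> g = h.

Definition zero_object z : Prop :=
  forall x, (forall f : hom x z, f = 0) /\ (forall f : hom z x, f = 0).

Definition is_kernel x y (f : hom x y) k (i : hom k x) : Prop :=
  f ∘ i = 0 /\
  forall w (g : hom w x), f ∘ g = 0 -> exists! h : hom w k, i ∘ h = g.
Definition is_cokernel x y (f : hom x y) q (p : hom y q) : Prop :=
  p ∘ f = 0 /\
  forall w (g : hom y w), g ∘ f = 0 -> exists! h : hom q w, h ∘ p = g.

Definition is_direct_sum n (s : 'I_n -> C) x : Prop :=
  exists (i : forall k, hom (s k) x) (p : forall k, hom x (s k)),
    [/\ forall k, p k ∘ i k = idm (s k),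
        forall k l, k != l -> p l ∘ i k = 0
      & \sum_k i k ∘ p k = idm x].

Definition pair_family x y : 'I_2 -> C := fun k => if k == ord0 then x else y.

Record is_abelian : Prop := {
  ab_zero : exists z, zero_object z;
  ab_biproduct : forall x y, exists s, is_direct_sum (pair_family x y) s;
  ab_kernel : forall x y (f : hom x y), exists k (i : hom k x), is_kernel f i;
  ab_cokernel : forall x y (f : hom x y),
    exists q (p : hom y q), is_cokernel f p;
  ab_monic : forall x y (f : hom x y), is_mono f ->
    exists z (g : hom y z), is_kernel g f;
  ab_epic : forall x y (f : hom x y), is_epi f ->
    exists w (g : hom w x), is_cokernel g f
}.

Definition is_simple x : Prop :=
  ~ zero_object x /\
  forall y (f : hom y x), is_mono f -> zero_object y \/ is_iso f.

Definition is_semisimple : Prop :=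
  forall x, exists n (s : 'I_n -> C), (forall k, is_simple (s k)) /\
    is_direct_sum s x.

Definition finitely_many_simples : Prop :=
  exists n (s : 'I_n -> C), forall x, is_simple x -> exists k, isomorphic x (s k).

(* For simple x over an algebraically closed field, f = scalar_of f *: idm x. *)
Definition scalar_of x (f : hom x x) : K := coord [tuple idm x] ord0 f.

End Abelian.

Record moncat (K : fieldType) := MonCat {
  mon_lin :> lincat K;
  tens : mon_lin -> mon_lin -> mon_lin;
  tensm : forall {x y x' y'},
    hom x x' -> hom y y' -> hom (tens x y) (tens x' y');
  unit_obj : mon_lin;
  assoc : forall x y z, hom (tens (tens x y) z) (tens x (tens y z));
  assocV : forall x y z, hom (tens x (tens y z)) (tens (tens x y) z);
  lunit : forall x, hom (tens unit_obj x) x;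
  lunitV : forall x, hom x (tens unit_obj x);
  runit : forall x, hom (tens x unit_obj) x;
  runitV : forall x, hom x (tens x unit_obj);
  tensm_id : forall x y, tensm (idm x) (idm y) = idm (tens x y);
  tensm_comp : forall x y x' y' x'' y''
      (f : hom x x') (f' : hom x' x'') (g : hom y y') (g' : hom y' y''),
    tensm (f' ∘ f) (g' ∘ g) = tensm f' g' ∘ tensm f g;
  tensm_linear_l : forall x y x' y' (g : hom y y'),
    linear (fun f : hom x x' => tensm f g);
  tensm_linear_r : forall x y x' y' (f : hom x x'),
    linear (fun g : hom y y' => tensm f g);
  assoc_iso : forall x y z, mutually_inverse (assoc x y z) (assocV x y z);
  lunit_iso : forall x, mutually_inverse (lunit x) (lunitV x);
  runit_iso : forall x, mutually_inverse (runit x) (runitV x);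
  assoc_nat : forall x y z x' y' z'
      (f : hom x x') (g : hom y y') (h : hom z z'),
    assoc x' y' z' ∘ tensm (tensm f g) h = tensm f (tensm g h) ∘ assoc x y z;
  lunit_nat : forall x y (f : hom x y),
    lunit y ∘ tensm (idm unit_obj) f = f ∘ lunit x;
  runit_nat : forall x y (f : hom x y),
    runit y ∘ tensm f (idm unit_obj) = f ∘ runit x;
  triangle : forall x y,
    tensm (idm x) (lunit y) ∘ assoc x unit_obj y = tensm (runit x) (idm y);
  pentagon : forall w x y z,
    assoc w x (tens y z) ∘ assoc (tens w x) y z =
    tensm (idm w) (assoc x y z) ∘ assoc w (tens x y) z
      ∘ tensm (assoc w x y) (idm z)
}.
Arguments tens {K m} x y : rename.
Arguments tensm {K m x y x' y'} f g : rename.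
Arguments unit_obj {K m}.
Arguments assoc {K m} x y z : rename.
Arguments assocV {K m} x y z : rename.
Arguments lunit {K m} x : rename.
Arguments lunitV {K m} x : rename.
Arguments runit {K m} x : rename.
Arguments runitV {K m} x : rename.

Notation "x ⊗ y" := (tens x y) (at level 35, right associativity) : cat_scope.
Notation "f ⊠ g" := (tensm f g) (at level 35, right associativity) : cat_scope.
Notation "'𝟙'" := unit_obj : cat_scope.

Record rigcat (K : fieldType) := RigCat {
  rig_mon :> moncat K;
  dualo : rig_mon -> rig_mon;
  ev : forall x, hom (dualo x ⊗ x) 𝟙;
  coev : forall x, hom 𝟙 (x ⊗ dualo x);
  zigzag_obj : forall x,
    runit x ∘ (idm x ⊠ ev x) ∘ assoc x (dualo x) x ∘ (coev x ⊠ idm x)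
      ∘ lunitV x = idm x;
  zigzag_dual : forall x,
    lunit (dualo x) ∘ (ev x ⊠ idm (dualo x)) ∘ assocV (dualo x) x (dualo x)
      ∘ (idm (dualo x) ⊠ coev x) ∘ runitV (dualo x) = idm (dualo x)
}.
Arguments dualo {K r} x : rename.
Arguments ev {K r} x : rename.
Arguments coev {K r} x : rename.

Section Duality.
Variables (K : fieldType) (C : rigcat K).
Implicit Types w x y : C.

(* The bijection hom (w ⊗ x) 𝟙 -> hom w (dualo x).                            *)
Definition mate w x (f : hom (w ⊗ x) 𝟙) : hom w (dualo x) :=
  lunit (dualo x) ∘ (f ⊠ idm (dualo x)) ∘ assocV w x (dualo x)
    ∘ (idm w ⊠ coev x) ∘ runitV w.

Definition dualm x y (f : hom x y) : hom (dualo y) (dualo x) :=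
  mate (ev y ∘ (idm (dualo y) ⊠ f)).

Definition dual_tens x y : hom (dualo y ⊗ dualo x) (dualo (x ⊗ y)) :=
  mate (ev y ∘ (idm (dualo y) ⊠ (lunit y ∘ (ev x ⊠ idm y) ∘ assocV (dualo x) x y))
          ∘ assoc (dualo y) (dualo x) (x ⊗ y)).

End Duality.

(* A pivotal structure is a monoidal natural isomorphism piv_x : x -> x^**.   *)
(* It makes dualo x a right dual of x as well, so that C is rigid.            *)
Record pivcat (K : fieldType) := PivCat {
  piv_rig :> rigcat K;
  piv : forall x : piv_rig, hom x (dualo (dualo x));
  pivV : forall x : piv_rig, hom (dualo (dualo x)) x;
  piv_iso : forall x, mutually_inverse (piv x) (pivV x);
  piv_nat : forall x y (f : hom x y), piv y ∘ f = dualm (dualm f) ∘ piv x;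
  piv_tens : forall x y,
    dualm (dual_tens x y) ∘ piv (x ⊗ y)
    = dual_tens (dualo y) (dualo x) ∘ (piv x ⊠ piv y)
}.
Arguments piv {K p} x : rename.
Arguments pivV {K p} x : rename.

Section Pivotal.
Variables (K : fieldType) (C : pivcat K).
Implicit Types x z : C.

(* coev_{z^*} : 𝟙 -> z^* ⊗ z^** followed by the identification z^** = z given *)
(* by the pivotal structure (the identity in the strict pivotal case).        *)
Definition coev_piv z : hom 𝟙 (dualo z ⊗ z) :=
  (idm (dualo z) ⊠ pivV z) ∘ coev (dualo z).

Definition pdim_mor x : hom (𝟙 : C) 𝟙 :=
  ev (dualo x) ∘ (piv x ⊠ idm (dualo x)) ∘ coev x.
Definition pdim x : K := scalar_of (pdim_mor x).

End Pivotal.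

Record sphfusion (K : fieldType) := SphFusion {
  fus_piv :> pivcat K;
  fus_abelian : is_abelian fus_piv;
  fus_semisimple : is_semisimple fus_piv;
  fus_finite : finitely_many_simples fus_piv;
  fus_unit : is_simple (𝟙 : fus_piv);
  fus_spherical : forall x : fus_piv, pdim_mor (dualo x) = pdim_mor x
}.

Record drinfeld_center (K : fieldType) (D : moncat K) := DrinfeldCenter {
  cen_obj : D;
  hbraid : forall y, hom (cen_obj ⊗ y) (y ⊗ cen_obj);
  hbraid_iso : forall y, is_iso (hbraid y);
  hbraid_nat : forall y y' (f : hom y y'),
    hbraid y' ∘ (idm cen_obj ⊠ f) = (f ⊠ idm cen_obj) ∘ hbraid y;
  hbraid_tens : forall y z,
    hbraid (y ⊗ z) =
    assocV y z cen_obj ∘ (idm y ⊠ hbraid z) ∘ assoc y cen_obj z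
      ∘ (hbraid y ⊠ idm z) ∘ assocV cen_obj y z
}.

Section Indicator.
Variables (K : fieldType) (D : sphfusion K) (X : drinfeld_center D) (z : D).
Let x := cen_obj X.

(* (ev_z ⊗ id) ∘ (id ⊗ f ⊗ id) ∘ (σ_{x,z^*} ⊗ id) ∘ (id ⊗ coev_{z^*}), with  *)
(* the coherence isomorphisms that are identities in the strict case.         *)
Definition FS_op21 (f : hom x (z ⊗ z)) : hom x (z ⊗ z) :=
  (lunit z ⊠ idm z)
    ∘ ((ev z ⊠ idm z) ⊠ idm z)
    ∘ (assocV (dualo z) z z ⊠ idm z)
    ∘ ((idm (dualo z) ⊠ f) ⊠ idm z)
    ∘ (hbraid X (dualo z) ⊠ idm z)
    ∘ assocV x (dualo z) z
    ∘ (idm x ⊠ coev_piv z)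
    ∘ runitV x.

Definition nu21 : K := trace_of FS_op21.

End Indicator.

Record brfusion (K : fieldType) := BrFusion {
  br_fus :> sphfusion K;
  braid : forall x y : br_fus, hom (x ⊗ y) (y ⊗ x);
  braidV : forall x y : br_fus, hom (y ⊗ x) (x ⊗ y);
  braid_iso : forall x y, mutually_inverse (braid x y) (braidV x y);
  braid_nat : forall x y x' y' (f : hom x x') (g : hom y y'),
    braid x' y' ∘ (f ⊠ g) = (g ⊠ f) ∘ braid x y;
  hexagon_r : forall x y z,
    braid x (y ⊗ z) =
    assocV y z x ∘ (idm y ⊠ braid x z) ∘ assoc y x z ∘ (braid x y ⊠ idm z)
      ∘ assocV x y z;
  hexagon_l : forall x y z,
    braid (x ⊗ y) z =
    assoc z x y ∘ (braid x z ⊠ idm y) ∘ assocV x z y ∘ (idm x ⊠ braid y z)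
      ∘ assoc x y z
}.
Arguments braid {K b} x y : rename.
Arguments braidV {K b} x y : rename.

Definition drinfeld_iso (K : fieldType) (C : brfusion K) (x : C) :
    hom x (dualo (dualo x)) :=
  mate (ev x ∘ braid x (dualo x)).

(* piv_twist says that the pivotal structure is the one associated with the   *)
(* ribbon structure; in the strict pivotal case it reads                      *)
(* ev_{x^*} = ev_x ∘ R_{x,x^*} ∘ (θ_x ⊗ id).                                  *)
Record premodular (K : fieldType) := Premodular {
  pm_br :> brfusion K;
  twist : forall x : pm_br, hom x x;
  twist_iso : forall x, is_iso (twist x);
  twist_nat : forall x y (f : hom x y), twist y ∘ f = f ∘ twist x;
  twist_tens : forall x y,
    twist (x ⊗ y) = (twist x ⊠ twist y) ∘ braid y x ∘ braid x y;
  twist_dual : forall x, dualm (twist x) = twist (dualo x);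
  piv_twist : forall x, piv x = drinfeld_iso x ∘ twist x
}.
Arguments twist {K p} x : rename.

(* The embedding x |-> (x, R^{-1}_{-,x}) into the Drinfeld center.            *)
Section CenterEmbed.
Variables (K : fieldType) (C : premodular K) (x : C).

Lemma center_embed_iso y : is_iso (braidV y x).
Proof. by have [h1 h2] := braid_iso y x; exists (braid y x). Qed.

Lemma center_embed_nat y y' (f : hom y y') :
  braidV y' x ∘ (idm x ⊠ f) = (f ⊠ idm x) ∘ braidV y x.
Proof.
have [h1 _] := braid_iso y' x; have [_ h2] := braid_iso y x.
rewrite -[LHS]compm_idr -[in LHS]h2 compmA -[braidV y' x ∘ _ ∘ _]compmA.
by rewrite -braid_nat compmA h1 compm_idl.
Qed.

Lemma tensm_idl_inv w y z (f : hom y z) (g : hom z y) :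
  mutually_inverse f g -> (idm (w : C) ⊠ g) ∘ (idm w ⊠ f) = idm (w ⊗ y).
Proof. by move=> [h _]; rewrite -tensm_comp compm_idl h tensm_id. Qed.

Lemma tensm_idr_inv w y z (f : hom y z) (g : hom z y) :
  mutually_inverse f g -> (g ⊠ idm (w : C)) ∘ (f ⊠ idm w) = idm (y ⊗ w).
Proof. by move=> [h _]; rewrite -tensm_comp compm_idl h tensm_id. Qed.

Lemma center_embed_tens y z :
  braidV (y ⊗ z) x =
  assocV y z x ∘ (idm y ⊠ braidV z x) ∘ assoc y x z
    ∘ (braidV y x ⊠ idm z) ∘ assocV x y z.
Proof.
set g := RHS; have [_ h] := braid_iso (y ⊗ z) x.
suff hg : g ∘ braid (y ⊗ z) x = idm _ by rewrite -[LHS]compm_idl -hg -compmA h compm_idr.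
rewrite hexagon_l /g -!compmA.
have [_ h1] := assoc_iso x y z; have [h1' _] := assoc_iso x y z.
have [h2 h2'] := assoc_iso y x z; have [h3 _] := assoc_iso y z x.
rewrite (compmA (assocV x y z)) h1' compm_idl (compmA (braidV y x ⊠ _)).
rewrite (tensm_idr_inv _ (braid_iso y x)) compm_idl (compmA (assoc y x z)) h2' compm_idl.
by rewrite (compmA (idm y ⊠ _)) (tensm_idl_inv _ (braid_iso z x)) compm_idl h3.
Qed.

Definition center_embed : drinfeld_center C :=
  @DrinfeldCenter K C x (fun y => braidV y x)
    center_embed_iso center_embed_nat center_embed_tens.

End CenterEmbed.

(* A complete set of pairwise non-isomorphic simple objects, indexed by I,    *)
(* containing the unit object (at index irr_unit).                            *)
Record irrset (K : fieldType) (C : premodular K) (I : finType) := IrrSet {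
  irr :> I -> C;
  irr_simple : forall i, is_simple (irr i);
  irr_inj : forall i j, isomorphic (irr i) (irr j) -> i = j;
  irr_complete : forall x : C, is_simple x -> exists i, isomorphic x (irr i);
  irr_unit : I;
  irr_unitE : irr irr_unit = 𝟙
}.

Section ModularData.
Variables (K : fieldType) (C : premodular K) (I : finType) (J : irrset C I).

(* fusN a b c is N_c^{a,b}: upper indices a and b, lower index c.             *)
Definition fusN (a b c : I) : nat := \dim {:hom (J a ⊗ J b) (J c)}.

Definition theta (a : I) : K := scalar_of (twist (J a)).
Definition qdim (a : I) : K := pdim (J a).
Definition dimC : K := \sum_k qdim k ^+ 2.

(* The index of the simple object isomorphic to the dual of J i; such an      *)
(* index exists and is unique, so that the default value is never used.       *)
Definition dual_idx (i : I) : I :=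
  odflt i [pick j | `[< isomorphic (dualo (J i)) (J j) >]].

Definition Smx (i j : I) : K :=
  (theta i)^-1 * (theta j)^-1 * \sum_k (fusN (dual_idx i) j k)%:R * theta k * qdim k.
Definition Tmx (i j : I) : K := (i == j)%:R * theta i.

Definition modular : Prop :=
  (\matrix_(i < #|I|, j < #|I|) Smx (enum_val i) (enum_val j)) \in unitmx.

Definition nu (a c : I) : K := nu21 (center_embed (J c)) (J a).

Definition gauge : Type := forall a b c, (fusN a b c).-tuple (hom (J a ⊗ J b) (J c)).
Definition is_gauge (B : gauge) : Prop := forall a b c, basis_of fullv (B a b c).

(* Rmap a b c is R_{a,b}^c; Rmx B a b c is its matrix relative to the bases   *)
(* B^{b,a}_c of the source and B^{a,b}_c of the target.                       *)
Definition Rmap (a b c : I) (p : hom (J b ⊗ J a) (J c)) : hom (J a ⊗ J b) (J c) :=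
  p ∘ braid (J a) (J b).
Definition Rmx (B : gauge) (a b c : I) : 'M[K]_(fusN a b c, fusN b a c) :=
  mx_of (B b a c) (B a b c) (@Rmap a b c).

End ModularData.

Definition braiding_form (K : fieldType) (C : premodular K)
    (disp : Order.disp_t) (I : finOrderType disp) (J : irrset C I)
    (sq : I -> K) (dp dm : I -> I -> nat) (B : gauge J) : Prop :=
  [/\ forall a b c, (b < a)%O ->
        eqmx_cast (Rmx B a b c) (1%:M : 'M[K]_(fusN J a b c)),
      forall a b c, (a < b)%O ->
        eqmx_cast (Rmx B a b c)
          ((theta J c / (theta J a * theta J b)) *: 1%:M : 'M[K]_(fusN J a b c))
    & forall a c,
        eqmx_cast (Rmx B a a c)
          ((sq c / theta J a) *:
             block_mx (1%:M : 'M[K]_(dp a c)) 0 0 (- 1%:M : 'M[K]_(dm a c)))].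

(* Main.v *)
From HB Require Import structures.
From mathcomp Require Import all_boot all_order all_algebra.
From mathcomp Require Import boolp reals complex ring zify.
Require Import Defs.

Set Implicit Arguments.
Unset Strict Implicit.
Unset Printing Implicit Defensive.

Import Order.TTheory GRing.Theory Num.Theory.
Local Open Scope ring_scope.
Local Open Scope cat_scope.

(** The braiding. On the multiplicity space of J c in J a ⊗ J a the braid generator R
    satisfies R^2 = theta_c / theta_a^2, because theta of a tensor product is theta ⊗ theta
    times the double braiding and theta is natural. So R is diagonalisable with eigenvalues
    ± sq c / theta a (square_root_basis), and the two multiplicities are determined by their
    sum, the fusion coefficient, and their difference, which is the trace of R up to a
    scalar. That trace is the indicator: the operator defining nu pulls one strand a around
    the other, and straightening the picture leaves R times the twist of a (FS_op21E,
    nu_homtr). For a different from b, the basis for one order of the strands is transported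
    by R from the basis for the other order, and the double braiding accounts for the
    remaining scalar (gauge_exists).

    The modular case. Evaluate, for simple l, the closure of R on two strands a encircled by
    a loop l. Splitting a ⊗ a into simple objects gives, up to the twist of a, the sum over
    c of nu a c times the Hopf link of c and l. Up to the braid relation and one yanking,
    the same link is the closure of the squared double braiding of l and a, which is a sum
    over the simple constituents of l ⊗ a (link_sum). Since S is, up to a dual, the matrix
    of the Hopf links, the formula for nu results by inverting S.

    The inversion needs S times its conjugate to be scalar. The rows of S, divided by the
    dimensions, are characters of the fusion ring (hopf_mul); as the matrix of fusion with
    i^* is the transpose of the matrix of fusion with i, a character takes conjugate values
    at i and i^* (char_conj), and distinct characters are orthogonal (char_orthogonal).
    Modularity makes the rows distinct, and symmetry of S forces all rows to have the same
    norm (Smx_row_norm). The same multiplicativity of the rows recovers the fusion rules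
    from S (fusN_determined).

    The diagrams are computed without strictifying the category. A morphism between tensor
    products is replaced by its family of right whiskerings with all objects z, rebracketed
    to the right (cap, cup, hat). Whiskering such a family further on the right is
    substitution for z, and on the left it is a tensor product with an identity, so no
    associator occurs in a computation any more, and the interchange law is naturality in z. *)

(** * Traces of linear maps *)

Section LinearMaps.
Variables (K : fieldType) (V W : vectType K) (f : V -> W).
Hypothesis lf : linear f.

Definition linear_map : {linear V -> W} :=
  HB.pack f (GRing.isLinear.Build K V W *:%R f lf).

Lemma lin0 : f 0 = 0. Proof. exact: (linear0 linear_map). Qed.
Lemma linZ a u : f (a *: u) = a *: f u.
Proof. exact: (linearZZ linear_map). Qed.
Lemma linB u v : f (u - v) = f u - f v.
Proof. exact: (linearB linear_map). Qed.
Lemma lin_sum (T : finType) (P : pred T) (F : T -> V) :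
  f (\sum_(i | P i) F i) = \sum_(i | P i) f (F i).
Proof. exact: (linear_sum linear_map). Qed.
Lemma lin_comb (T : finType) (a : T -> K) (F : T -> V) :
  f (\sum_i a i *: F i) = \sum_i a i *: f (F i).
Proof. by rewrite lin_sum; apply: eq_bigr => i _; rewrite linZ. Qed.

Lemma leq_dim_inj : (forall v, f v = 0 -> v = 0) -> (\dim {:V} <= \dim {:W})%N.
Proof.
move=> inj; pose g := linfun linear_map.
have /limg_dim_eq <- : (fullv :&: lker g = 0)%VS.
  apply/eqP; rewrite -subv0; apply/subvP => v; rewrite memv_cap memvf memv_ker /=.
  by rewrite lfunE /= memv0 => /eqP /inj ->.
by rewrite dimvS ?subvf.
Qed.
End LinearMaps.

Section Trace.
Variable K : fieldType.

(** Expand the trace over e and each e_j over v, and exchange the two sums. Allowing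
    spanning families v with coordinate forms matters below, where v is padded with zeros. *)
Lemma mxtrace_frame (V : vectType K) n (e : n.-tuple V) (T : finType)
    (v : T -> V) (phi : T -> V -> K) (f : V -> V) :
  basis_of fullv e -> linear f -> (forall t, linear (phi t : V -> K^o)) ->
  (forall u, u = \sum_t phi t u *: v t) ->
  \tr (mx_of e e f) = \sum_t phi t (f (v t)).
Proof.
move=> be lf lphi hv; rewrite /mxtrace.
under eq_bigr => j _ do
  rewrite mxE [X in f X]hv (lin_comb lf) linear_sum.
rewrite exchange_big.
apply: eq_bigr => t _.
rewrite [f (v t) in RHS](coord_basis be (memvf (f (v t)))) (lin_comb (lphi t)).
by apply: eq_bigr => j _; rewrite linearZ /= mulrC.
Qed.

Lemma trace_frame (V : vectType K) (T : finType)
    (v : T -> V) (phi : T -> V -> K) (f : V -> V) :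
  linear f -> (forall t, linear (phi t : V -> K^o)) ->
  (forall u, u = \sum_t phi t u *: v t) ->
  trace_of f = \sum_t phi t (f (v t)).
Proof. by apply: mxtrace_frame; apply: vbasisP. Qed.

Lemma trace_basis (V : vectType K) n (e : n.-tuple V) (f : V -> V) :
  basis_of fullv e -> linear f -> trace_of f = \tr (mx_of e e f).
Proof.
move=> be lf; rewrite (trace_frame (v := fun i : 'I_n => e`_i) (phi := coord e) lf) //.
- by apply: eq_bigr => i _; rewrite mxE.
- by move=> t; apply: linearP.
- by move=> u; apply: coord_basis (memvf u).
Qed.

Lemma dim_frame (V : vectType K) (T : finType) (v : T -> V) (phi : T -> V -> K) :
  (forall t, linear (phi t : V -> K^o)) ->
  (forall u, u = \sum_t phi t u *: v t) ->
  (\dim {:V})%:R = \sum_t phi t (v t).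
Proof.
move=> lphi hv; rewrite -(trace_frame (f := id) _ lphi hv) //.
rewrite /trace_of -[LHS]mxtrace1; congr (\tr _); apply/matrixP => i j.
by rewrite !mxE coord_free ?(basis_free (vbasisP _)) // eq_sym.
Qed.

End Trace.

Import VectorInternalTheory.

(** Over an algebraically closed field the characteristic polynomial has a root as soon as
    the space is nonzero. *)
Lemma eigenvector_exists (K : closedFieldType) (V : vectType K) (f : V -> V) (v0 : V) :
  linear f -> v0 != 0 -> exists a v, v != 0 /\ f v = a *: v.
Proof.
move=> lf v0n0; pose g : {linear _ -> _} := v2r \o linear_map lf \o r2v.
pose A := lin1_mx g.
have dV : (0 < dim V)%N.
  rewrite lt0n; apply: contra v0n0 => /eqP d0.
  rewrite -[v0]v2rK; apply/eqP; rewrite -[RHS](v2rK) linear0; congr r2v.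
  apply/rowP => i; by have := ltn_ord i; rewrite [X in (_ < X)%N]d0.
have /closed_rootP[a ra] : size (char_poly A) != 1 by rewrite size_char_poly; case: (dim V) dV.
move: ra; rewrite -eigenvalue_root_char => /eigenvalueP[v].
rewrite mul_rV_lin1 /= => hv vn0; exists a, (r2v v); split.
  by rewrite -(inj_eq (can_inj v2rK)) r2vK linear0.
by apply: (can_inj v2rK); rewrite hv linearZ /= r2vK.
Qed.

(** * Composition in linear categories *)

Section LinCat.
Variables (K : fieldType) (C : lincat K).
Implicit Types w x y z : C.

Lemma comp0m x y z (f : hom x y) : (0 : hom y z) ∘ f = 0.
Proof. exact: (lin0 (compm_linear_l f)). Qed.
Lemma compm0 x y z (g : hom y z) : g ∘ (0 : hom x y) = 0.
Proof. exact: (lin0 (compm_linear_r g)). Qed.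
Lemma compZm x y z a (g : hom y z) (f : hom x y) : (a *: g) ∘ f = a *: (g ∘ f).
Proof. exact: (linZ (compm_linear_l f)). Qed.
Lemma compmZ x y z a (g : hom y z) (f : hom x y) : g ∘ (a *: f) = a *: (g ∘ f).
Proof. exact: (linZ (compm_linear_r g)). Qed.
Lemma compBm x y z (g h : hom y z) (f : hom x y) : (g - h) ∘ f = g ∘ f - h ∘ f.
Proof. exact: (linB (compm_linear_l f)). Qed.
Lemma compm_suml (T : finType) x y z (g : T -> hom y z) (f : hom x y) :
  (\sum_t g t) ∘ f = \sum_t (g t ∘ f).
Proof. exact: (lin_sum (compm_linear_l f)). Qed.
Lemma compm_sumr (T : finType) x y z (g : hom y z) (f : T -> hom x y) :
  g ∘ (\sum_t f t) = \sum_t (g ∘ f t).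
Proof. exact: (lin_sum (compm_linear_r g)). Qed.

(** Compositions are kept nested to the right. This lemma and the next ones turn an equation
    between composites of two (or three) morphisms into one that rewrites inside such a
    chain, in front of an arbitrary tail h; the digits count the factors before and after.
    In comp3r there is no tail. *)
Lemma comp22 w x y y' z (g : hom y z) (f : hom x y) (g' : hom y' z) (f' : hom x y') :
  g ∘ f = g' ∘ f' -> forall h : hom w x, g ∘ (f ∘ h) = g' ∘ (f' ∘ h).
Proof. by move=> e h; rewrite !compmA e. Qed.
Lemma comp21 w x y z (g : hom y z) (f : hom x y) (g' : hom x z) :
  g ∘ f = g' -> forall h : hom w x, g ∘ (f ∘ h) = g' ∘ h.
Proof. by move=> e h; rewrite !compmA e. Qed.
Lemma comp20 w x y (g : hom y x) (f : hom x y) :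
  g ∘ f = idm x -> forall h : hom w x, g ∘ (f ∘ h) = h.
Proof. by move=> e h; rewrite compmA e compm_idl. Qed.
Lemma comp31 v w x y z (g : hom y z) (f : hom x y) (e : hom w x) (r : hom w z) :
  g ∘ f ∘ e = r -> forall h : hom v w, g ∘ (f ∘ (e ∘ h)) = r ∘ h.
Proof. by move=> <- h; rewrite !compmA. Qed.
Lemma comp3r w x y z (g : hom y z) (f : hom x y) (e : hom w x) (r : hom w z) :
  g ∘ f ∘ e = r -> g ∘ (f ∘ e) = r.
Proof. by rewrite compmA. Qed.

Lemma inv_sym x y (f : hom x y) g : mutually_inverse f g -> mutually_inverse g f.
Proof. by case. Qed.
Lemma inv_comp x y z (f : hom x y) f' (g : hom y z) g' :
  mutually_inverse f f' -> mutually_inverse g g' -> mutually_inverse (g ∘ f) (f' ∘ g').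
Proof.
by move=> [f1 f2] [g1 g2]; split; rewrite -compmA (compmA g', compmA f) ?g1 ?f2 compm_idl.
Qed.
Lemma inv_inj x y (f : hom x y) f' : mutually_inverse f f' ->
  forall w (g h : hom w x), f ∘ g = f ∘ h -> g = h.
Proof. by move=> [e _] w g h /(congr1 (compm f')); rewrite !compmA e !compm_idl. Qed.
Lemma inv_injr x y (f : hom x y) f' : mutually_inverse f f' ->
  forall w (g h : hom y w), g ∘ f = h ∘ f -> g = h.
Proof. by move=> [_ e] w g h /(congr1 (compm^~ f')); rewrite -!compmA e !compm_idr. Qed.
Lemma inv_uniq x y (f : hom x y) g g' :
  mutually_inverse f g -> mutually_inverse f g' -> g = g'.
Proof.
by move=> [e _] [_ e']; rewrite -[LHS]compm_idr -e' compmA e compm_idl.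
Qed.

(** A commutative square with invertible horizontal sides stays commutative for their
    inverses; this yields the naturality of the inverse structure maps. *)
Lemma inv_square x y x' y' (f : hom x y) fV (f' : hom x' y') f'V (g : hom x x') (h : hom y y') :
  mutually_inverse f fV -> mutually_inverse f' f'V -> f' ∘ g = h ∘ f -> f'V ∘ h = g ∘ fV.
Proof.
move=> [e1 e2] [e1' e2'] e.
by rewrite -[h]compm_idr -e2 !compmA -(compmA _ h) -e compmA e1' compm_idl.
Qed.
Lemma isomorphic_sym x y : isomorphic x y -> isomorphic y x.
Proof. by case=> f [g /inv_sym e]; exists g, f. Qed.
Lemma isomorphic_trans x y z : isomorphic x y -> isomorphic y z -> isomorphic x z.
Proof. by case=> f [f' e] [g [g' e']]; exists (g ∘ f), (f' ∘ g'); apply: inv_comp. Qed.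
End LinCat.

(** * Coherence and right whiskerings in monoidal categories *)

Section MonCat.
Variables (K : fieldType) (C : moncat K).
Implicit Types u v w x y z : C.

Lemma tens0m x y x' y' (g : hom y y') : (0 : hom x x') ⊠ g = 0.
Proof. exact: (lin0 (tensm_linear_l g)). Qed.
Lemma tensm0 x y x' y' (f : hom x x') : f ⊠ (0 : hom y y') = 0.
Proof. exact: (lin0 (tensm_linear_r f)). Qed.
Lemma tensZm x y x' y' a (f : hom x x') (g : hom y y') : (a *: f) ⊠ g = a *: (f ⊠ g).
Proof. exact: (linZ (tensm_linear_l g)). Qed.
Lemma tensmZ x y x' y' a (f : hom x x') (g : hom y y') : f ⊠ (a *: g) = a *: (f ⊠ g).
Proof. exact: (linZ (tensm_linear_r f)). Qed.
Lemma tensm_sumr (T : finType) x y x' y' (f : hom x x') (g : T -> hom y y') :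
  f ⊠ (\sum_t g t) = \sum_t (f ⊠ g t).
Proof. exact: (lin_sum (tensm_linear_r f)). Qed.

Lemma tens_compl x x' x'' y (g : hom x' x'') (f : hom x x') :
  (g ∘ f) ⊠ idm y = (g ⊠ idm y) ∘ (f ⊠ idm y).
Proof. by rewrite -tensm_comp compm_idl. Qed.
Lemma tens_compr x y y' y'' (g : hom y' y'') (f : hom y y') :
  idm x ⊠ (g ∘ f) = (idm x ⊠ g) ∘ (idm x ⊠ f).
Proof. by rewrite -tensm_comp compm_idl. Qed.
Lemma tens_split x x' y y' (f : hom x x') (g : hom y y') :
  f ⊠ g = (f ⊠ idm y') ∘ (idm x ⊠ g).
Proof. by rewrite -tensm_comp compm_idl compm_idr. Qed.
Lemma tens_splitC x x' y y' (f : hom x x') (g : hom y y') :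
  f ⊠ g = (idm x' ⊠ g) ∘ (f ⊠ idm y).
Proof. by rewrite -tensm_comp compm_idl compm_idr. Qed.
Lemma interchange x x' y y' (f : hom x x') (g : hom y y') :
  (f ⊠ idm y') ∘ (idm x ⊠ g) = (idm x' ⊠ g) ∘ (f ⊠ idm y).
Proof. by rewrite -tens_split tens_splitC. Qed.
Lemma inv_tens x x' y y' (f : hom x x') fV (g : hom y y') gV :
  mutually_inverse f fV -> mutually_inverse g gV -> mutually_inverse (f ⊠ g) (fV ⊠ gV).
Proof. by move=> [f1 f2] [g1 g2]; split; rewrite -tensm_comp ?f1 ?g1 ?f2 ?g2 tensm_id. Qed.
Lemma inv_id x : mutually_inverse (idm x) (idm x).
Proof. by split; rewrite compm_idl. Qed.

Lemma assocK x y z : assocV x y z ∘ assoc x y z = idm _. Proof. by case: (assoc_iso x y z). Qed.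
Lemma assocVK x y z : assoc x y z ∘ assocV x y z = idm _. Proof. by case: (assoc_iso x y z). Qed.
Lemma lunitVK x : lunit x ∘ lunitV x = idm _. Proof. by case: (lunit_iso x). Qed.
Lemma runitVK x : runit x ∘ runitV x = idm _. Proof. by case: (runit_iso x). Qed.

Lemma tens_invr x y z (g : hom y z) (f : hom z y) :
  f ∘ g = idm _ -> (idm x ⊠ f) ∘ (idm x ⊠ g) = idm _.
Proof. by move=> e; rewrite -tens_compr e tensm_id. Qed.
Lemma tens_invl x y z (g : hom y z) (f : hom z y) :
  f ∘ g = idm _ -> (f ⊠ idm x) ∘ (g ⊠ idm x) = idm _.
Proof. by move=> e; rewrite -tens_compl e tensm_id. Qed.

Lemma assocV_nat x y z x' y' z' (f : hom x x') (g : hom y y') (h : hom z z') :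
  assocV x' y' z' ∘ (f ⊠ (g ⊠ h)) = ((f ⊠ g) ⊠ h) ∘ assocV x y z.
Proof. exact: inv_square (assoc_iso _ _ _) (assoc_iso _ _ _) (assoc_nat _ _ _). Qed.
Lemma lunitV_nat x y (f : hom x y) : lunitV y ∘ f = (idm 𝟙 ⊠ f) ∘ lunitV x.
Proof. exact: inv_square (lunit_iso _) (lunit_iso _) (lunit_nat _). Qed.
Lemma runitV_nat x y (f : hom x y) : runitV y ∘ f = (f ⊠ idm 𝟙) ∘ runitV x.
Proof. exact: inv_square (runit_iso _) (runit_iso _) (runit_nat _). Qed.

Lemma tens1_inj x y (f g : hom x y) : f ⊠ idm 𝟙 = g ⊠ idm 𝟙 -> f = g.
Proof.
move=> e; apply: (inv_injr (runit_iso x)).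
by rewrite -!runit_nat e.
Qed.
Lemma tens1l_inj x y (f g : hom x y) : idm 𝟙 ⊠ f = idm 𝟙 ⊠ g -> f = g.
Proof.
move=> e; apply: (inv_injr (lunit_iso x)).
by rewrite -!lunit_nat e.
Qed.

(** Kelly's argument: the left unit is faithful on morphisms, and after tensoring with the
    unit the identity is a face of a pentagon whose other faces are triangles and naturality
    squares. *)
Lemma lunit_tens x y : lunit (x ⊗ y) ∘ assoc 𝟙 x y = lunit x ⊠ idm y.
Proof.
apply: tens1l_inj; rewrite tens_compr.
apply: (inv_injr (assoc_iso 𝟙 (𝟙 ⊗ x) y)).
apply: (inv_injr (inv_tens (assoc_iso 𝟙 𝟙 x) (inv_id y))).
rewrite -!compmA [(idm 𝟙 ⊠ assoc _ _ _) ∘ _]compmA -pentagon !compmA triangle.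
rewrite -tensm_id -assoc_nat -[(idm 𝟙 ⊠ _) ∘ _]assoc_nat.
by rewrite -(compmA (assoc _ _ _)) -tens_compl triangle.
Qed.

(** The same argument as for lunit_tens, tensoring with the unit on the other side. *)
Lemma runit_tens x y : (idm x ⊠ runit y) ∘ assoc x y 𝟙 = runit (x ⊗ y).
Proof.
apply: tens1_inj; rewrite tens_compl.
apply: (inv_inj (assoc_iso x y 𝟙)).
rewrite compmA assoc_nat -triangle tens_compr -!compmA (compmA (idm x ⊠ assoc _ _ _)).
by rewrite -pentagon !compmA -assoc_nat tensm_id -!compmA triangle.
Qed.

Lemma lunit_unit : lunit (𝟙 : C) = runit 𝟙.
Proof.
apply: tens1_inj; rewrite -triangle -lunit_tens; congr (_ ∘ _).
by apply: (inv_inj (lunit_iso 𝟙)); rewrite lunit_nat.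
Qed.

Lemma lunitV_tens x y : assocV 𝟙 x y ∘ lunitV (x ⊗ y) = lunitV x ⊠ idm y.
Proof.
apply: (inv_uniq (f := lunit x ⊠ idm y)); last exact: inv_tens (lunit_iso x) (inv_id y).
by rewrite -lunit_tens; apply: inv_comp (assoc_iso _ _ _) (lunit_iso _).
Qed.
Lemma triangleV x y : assocV x 𝟙 y ∘ (idm x ⊠ lunitV y) = runitV x ⊠ idm y.
Proof.
apply: (inv_uniq (f := runit x ⊠ idm y)); last exact: inv_tens (runit_iso x) (inv_id y).
by rewrite -triangle; apply: inv_comp (assoc_iso _ _ _) (inv_tens (inv_id x) (lunit_iso _)).
Qed.
Lemma pentagonV w x y z :
  (assocV w x y ⊠ idm z) ∘ assocV w (x ⊗ y) z ∘ (idm w ⊠ assocV x y z)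
  = assocV (w ⊗ x) y z ∘ assocV w x (y ⊗ z).
Proof.
apply: (inv_uniq (f := assoc w x (y ⊗ z) ∘ assoc (w ⊗ x) y z)).
  rewrite pentagon -compmA; apply: inv_comp.
    exact: inv_comp (inv_tens (assoc_iso _ _ _) (inv_id _)) (assoc_iso _ _ _).
  exact: inv_tens (inv_id _) (assoc_iso _ _ _).
exact: inv_comp (assoc_iso _ _ _) (assoc_iso _ _ _).
Qed.

(** The pentagon, solved for an associator whiskered on the right: this and the following
    variants are what removes such associators from a chain. *)
Lemma pentagon_tens w x y z :
  assoc w (x ⊗ y) z ∘ (assoc w x y ⊠ idm z) ∘ assocV (w ⊗ x) y z
  = (idm w ⊠ assocV x y z) ∘ assoc w x (y ⊗ z).
Proof.
apply: (inv_injr (assoc_iso (w ⊗ x) y z)).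
rewrite -[LHS]compmA assocK compm_idr -compmA pentagon !compmA -tens_compr assocK.
by rewrite tensm_id compm_idl.
Qed.
Lemma pentagonV_tens w x y z :
  (assocV w x y ⊠ idm z) ∘ assocV w (x ⊗ y) z
  = assocV (w ⊗ x) y z ∘ assocV w x (y ⊗ z) ∘ (idm w ⊠ assoc x y z).
Proof. by rewrite -pentagonV -compmA -tens_compr assocK tensm_id compm_idr. Qed.
Lemma pentagonV_tens_mid w x y z :
  assoc (w ⊗ x) y z ∘ (assocV w x y ⊠ idm z) ∘ assocV w (x ⊗ y) z
  = assocV w x (y ⊗ z) ∘ (idm w ⊠ assoc x y z).
Proof. by rewrite -compmA pentagonV_tens !compmA assocVK compm_idl. Qed.

Lemma pentagonV_tens_r w x y z :
  assoc w x (y ⊗ z) ∘ assoc (w ⊗ x) y z ∘ (assocV w x y ⊠ idm z)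
  = (idm w ⊠ assoc x y z) ∘ assoc w (x ⊗ y) z.
Proof. by rewrite pentagon -compmA -tens_compl assocVK tensm_id compm_idr. Qed.

Lemma pentagon_tens_l w x y z :
  assoc w (x ⊗ y) z ∘ (assoc w x y ⊠ idm z)
  = (idm w ⊠ assocV x y z) ∘ (assoc w x (y ⊗ z) ∘ assoc (w ⊗ x) y z).
Proof. by rewrite compmA -pentagon_tens -!compmA assocK compm_idr. Qed.
Lemma pentagonV_tens_l w x y z :
  assoc (w ⊗ x) y z ∘ (assocV w x y ⊠ idm z)
  = assocV w x (y ⊗ z) ∘ ((idm w ⊠ assoc x y z) ∘ assoc w (x ⊗ y) z).
Proof. by rewrite -pentagonV_tens_r -!compmA (comp20 (assocK _ _ _)). Qed.

(** The right whiskerings of e, g and f by z, rebracketed so that z is the last factor of a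
    tensor product nested to the right. They are locked because the lemmas on composition
    would otherwise match inside their bodies. *)
Definition cap u v (e : hom (u ⊗ v) 𝟙) z : hom (u ⊗ (v ⊗ z)) z :=
  locked (lunit z ∘ (e ⊠ idm z) ∘ assocV u v z).
Definition cup u v (g : hom 𝟙 (u ⊗ v)) z : hom z (u ⊗ (v ⊗ z)) :=
  locked (assoc u v z ∘ (g ⊠ idm z) ∘ lunitV z).
Definition hat x w y v (f : hom (x ⊗ w) (y ⊗ v)) z : hom (x ⊗ (w ⊗ z)) (y ⊗ (v ⊗ z)) :=
  locked (assoc y v z ∘ (f ⊠ idm z) ∘ assocV x w z).
Lemma capE u v (e : hom (u ⊗ v) 𝟙) z :
  cap e z = lunit z ∘ (e ⊠ idm z) ∘ assocV u v z.
Proof. by rewrite /cap -lock. Qed.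
Lemma cupE u v (g : hom 𝟙 (u ⊗ v)) z :
  cup g z = assoc u v z ∘ (g ⊠ idm z) ∘ lunitV z.
Proof. by rewrite /cup -lock. Qed.
Lemma hatE x w y v (f : hom (x ⊗ w) (y ⊗ v)) z :
  hat f z = assoc y v z ∘ (f ⊠ idm z) ∘ assocV x w z.
Proof. by rewrite /hat -lock. Qed.

Lemma cap_nat u v (e : hom (u ⊗ v) 𝟙) z z' (h : hom z z') :
  cap e z' ∘ (idm u ⊠ (idm v ⊠ h)) = h ∘ cap e z.
Proof.
by rewrite !capE -!compmA assocV_nat tensm_id (comp22 (interchange _ _)) (comp22 (lunit_nat _)).
Qed.
Lemma cup_nat u v (g : hom 𝟙 (u ⊗ v)) z z' (h : hom z z') :
  (idm u ⊠ (idm v ⊠ h)) ∘ cup g z = cup g z' ∘ h.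
Proof.
rewrite !cupE -!compmA lunitV_nat (comp22 (interchange _ _)) -tensm_id.
by rewrite (comp22 (assoc_nat _ _ _)).
Qed.
Lemma hat_nat x w y v (f : hom (x ⊗ w) (y ⊗ v)) z z' (h : hom z z') :
  hat f z' ∘ (idm x ⊠ (idm w ⊠ h)) = (idm y ⊠ (idm v ⊠ h)) ∘ hat f z.
Proof.
rewrite !hatE -!compmA assocV_nat tensm_id (comp22 (interchange _ _)).
by rewrite -tensm_id (comp22 (assoc_nat _ _ _)).
Qed.

Lemma cup_nat_r x u v (g : hom 𝟙 (u ⊗ v)) z z' (h : hom z z') :
  (idm x ⊠ (idm u ⊠ (idm v ⊠ h))) ∘ (idm x ⊠ cup g z) = (idm x ⊠ cup g z') ∘ (idm x ⊠ h).
Proof. by rewrite -!tens_compr cup_nat. Qed.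
Lemma cap_tens u v u' v' (e : hom (u ⊗ v) 𝟙) (p : hom u' u) (q : hom v' v) z :
  cap (e ∘ (p ⊠ q)) z = cap e z ∘ (p ⊠ (q ⊠ idm z)).
Proof. by rewrite !capE tens_compl -!compmA assocV_nat. Qed.
Lemma cup_tens u v u' v' (g : hom 𝟙 (u ⊗ v)) (p : hom u u') (q : hom v v') z :
  cup ((p ⊠ q) ∘ g) z = (p ⊠ (q ⊠ idm z)) ∘ cup g z.
Proof. by rewrite !cupE tens_compl -!compmA (comp22 (assoc_nat _ _ _)). Qed.
Lemma hat_tens x w y v (p : hom x y) (q : hom w v) z :
  hat (p ⊠ q) z = p ⊠ (q ⊠ idm z).
Proof. by rewrite !hatE assoc_nat -compmA assocVK compm_idr. Qed.
Lemma cap_hat u v u' v' (e : hom (u ⊗ v) 𝟙) (f : hom (u' ⊗ v') (u ⊗ v)) z :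
  cap (e ∘ f) z = cap e z ∘ hat f z.
Proof. by rewrite !capE !hatE tens_compl -!compmA (comp20 (assocK _ _ _)). Qed.
Lemma hat_comp u v u' v' u'' v'' (g : hom (u' ⊗ v') (u'' ⊗ v''))
    (f : hom (u ⊗ v) (u' ⊗ v')) z : hat (g ∘ f) z = hat g z ∘ hat f z.
Proof. by rewrite !hatE tens_compl -!compmA (comp20 (assocK _ _ _)). Qed.

Lemma cap_inj u v (e e' : hom (u ⊗ v) 𝟙) : cap e 𝟙 = cap e' 𝟙 -> e = e'.
Proof.
rewrite !capE => /(inv_injr (inv_sym (assoc_iso _ _ _))) /(inv_inj (lunit_iso _)).
exact: tens1_inj.
Qed.
Lemma cup_inj u v (g g' : hom 𝟙 (u ⊗ v)) : cup g 𝟙 = cup g' 𝟙 -> g = g'.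
Proof.
rewrite !cupE => /(inv_injr (inv_sym (lunit_iso _))) /(inv_inj (assoc_iso _ _ _)).
exact: tens1_inj.
Qed.

Lemma cap_whisk u v (e : hom (u ⊗ v) 𝟙) y z :
  (cap e y ⊠ idm z) ∘ assocV u (v ⊗ y) z = cap e (y ⊗ z) ∘ (idm u ⊠ assoc v y z).
Proof.
rewrite !capE !tens_compl -!compmA pentagonV_tens -!compmA -lunit_tens -!compmA.
by rewrite -(comp22 (assocV_nat _ _ _)) tensm_id (comp20 (assocVK _ _ _)).
Qed.
Lemma cup_whisk u v (g : hom 𝟙 (u ⊗ v)) y z :
  assoc u (v ⊗ y) z ∘ (cup g y ⊠ idm z) = (idm u ⊠ assocV v y z) ∘ cup g (y ⊗ z).
Proof.
rewrite !cupE !tens_compl -lunitV_tens.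
by rewrite -!compmA -(comp22 (assocV_nat _ _ _)) tensm_id !compmA pentagon_tens.
Qed.

(** The bracketed composite is the usual zigzag, with its associator and unit isomorphisms;
    on the left it is a composite of two strict pieces. *)
Lemma zigzag_cup w u d (e : hom (d ⊗ u) 𝟙) (g : hom 𝟙 (w ⊗ d)) z :
  (idm w ⊠ cap e z) ∘ cup g (u ⊗ z) =
  (runit w ∘ (idm w ⊠ e) ∘ assoc w d u ∘ (g ⊠ idm u) ∘ lunitV u) ⊠ idm z.
Proof.
rewrite !tens_compl -triangle -lunitV_tens !capE !tens_compr !cupE -!compmA.
rewrite -(comp22 (assocV_nat _ _ _)) tensm_id (comp22 (assoc_nat _ _ _)).
congr (_ ∘ (_ ∘ _)); rewrite !compmA; congr (_ ∘ _ ∘ _).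
by rewrite pentagon_tens.
Qed.
Lemma zigzag_cap w x d (f : hom (w ⊗ x) 𝟙) (g : hom 𝟙 (x ⊗ d)) z :
  cap f (d ⊗ z) ∘ (idm w ⊠ cup g z) =
  (lunit d ∘ (f ⊠ idm d) ∘ assocV w x d ∘ (idm w ⊠ g) ∘ runitV w) ⊠ idm z.
Proof.
rewrite !tens_compl -lunit_tens -triangleV !cupE !tens_compr !capE -!compmA.
rewrite -(comp22 (assocV_nat _ _ _)) (comp22 (assoc_nat _ _ _)) tensm_id.
congr (_ ∘ (_ ∘ _)); rewrite !compmA; congr (_ ∘ _ ∘ _).
by rewrite pentagonV_tens_mid.
Qed.

(** Nested contractions become composites of families, which is why duals of tensor products
    can be handled one factor at a time. *)
Lemma cap_nested x y w v (e : hom (w ⊗ y) 𝟙) (e' : hom (v ⊗ x) 𝟙) z :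
  cap (e ∘ (idm w ⊠ cap e' y) ∘ assoc w v (x ⊗ y)) z =
  cap e z ∘ (idm w ⊠ cap e' (y ⊗ z)) ∘ (idm w ⊠ (idm v ⊠ assoc x y z))
    ∘ assoc w v ((x ⊗ y) ⊗ z).
Proof.
transitivity (lunit z ∘ (e ⊠ idm z) ∘ assocV w y z
    ∘ (idm w ⊠ ((cap e' y ⊠ idm z) ∘ assocV v (x ⊗ y) z)) ∘ assoc w v ((x ⊗ y) ⊗ z)).
  rewrite (tens_compr w (cap e' y ⊠ idm z)) {1}capE !tens_compl -!compmA.
  rewrite (comp22 (assocV_nat _ _ _)).
  congr (_ ∘ (_ ∘ (_ ∘ _))).
  by rewrite -pentagon_tens !compmA assocK compm_idl.
by rewrite cap_whisk tens_compr (capE e) -!compmA.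
Qed.
Lemma cup_nested x y w v (g : hom 𝟙 (y ⊗ w)) (g' : hom 𝟙 (x ⊗ v)) z :
  assoc x y ((w ⊗ v) ⊗ z) ∘ cup (assocV x y (w ⊗ v) ∘ (idm x ⊠ cup g v) ∘ g') z =
  (idm x ⊠ (idm y ⊠ assocV w v z)) ∘ (idm x ⊠ cup g (v ⊗ z)) ∘ cup g' z.
Proof.
rewrite -tens_compr -cup_whisk tens_compr [cup g' z]cupE.
rewrite -!compmA -(comp22 (assoc_nat _ _ _)) {1}cupE !tens_compl.
by rewrite !compmA pentagonV_tens_r -!compmA.
Qed.
Lemma hat_whisk y x w x' v (f : hom (x ⊗ w) (x' ⊗ v)) z :
  assoc y x' (v ⊗ z) ∘ hat (assocV y x' v ∘ (idm y ⊠ f) ∘ assoc y x w) z =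
  (idm y ⊠ hat f z) ∘ assoc y x (w ⊗ z).
Proof.
rewrite !hatE !tens_compl !tens_compr -!compmA (comp31 (pentagonV_tens_r _ _ _ _)) -!compmA.
by rewrite (comp22 (assoc_nat _ _ _)) (comp3r (pentagon_tens _ _ _ _)).
Qed.
Lemma cap_cup u v (e : hom (u ⊗ v) 𝟙) (g : hom 𝟙 (u ⊗ v)) z :
  cap e z ∘ cup g z = lunit z ∘ ((e ∘ g) ⊠ idm z) ∘ lunitV z.
Proof. by rewrite capE cupE tens_compl -!compmA (comp20 (assocK _ _ _)). Qed.
Lemma cap_cup_inj u v u' v' (e : hom (u ⊗ v) 𝟙) (g : hom 𝟙 (u ⊗ v))
    (e' : hom (u' ⊗ v') 𝟙) (g' : hom 𝟙 (u' ⊗ v')) :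
  cap e 𝟙 ∘ cup g 𝟙 = cap e' 𝟙 ∘ cup g' 𝟙 -> e ∘ g = e' ∘ g'.
Proof.
rewrite !cap_cup => /(inv_injr (inv_sym (lunit_iso _))) /(inv_inj (lunit_iso _)).
exact: tens1_inj.
Qed.
End MonCat.

(** * Duality and the pivotal trace *)

Section Rigid.
Variables (K : fieldType) (C : rigcat K).
Implicit Types u v w x y z : C.

Lemma cap_cup_obj x z : (idm x ⊠ cap (ev x) z) ∘ cup (coev x) (x ⊗ z) = idm _.
Proof. by rewrite zigzag_cup zigzag_obj tensm_id. Qed.
Lemma cap_cup_dual x z : cap (ev x) (dualo x ⊗ z) ∘ (idm _ ⊠ cup (coev x) z) = idm _.
Proof. by rewrite zigzag_cap zigzag_dual tensm_id. Qed.
Lemma mate_whisk w x (f : hom (w ⊗ x) 𝟙) z :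
  mate f ⊠ idm z = cap f (dualo x ⊗ z) ∘ (idm w ⊠ cup (coev x) z).
Proof. by rewrite zigzag_cap. Qed.

Lemma ev_mate w x (f : hom (w ⊗ x) 𝟙) : ev x ∘ (mate f ⊠ idm x) = f.
Proof.
apply: cap_inj; rewrite cap_tens tensm_id mate_whisk compmA -cap_nat -compmA -tens_compr.
by rewrite cap_cup_obj tensm_id compm_idr.
Qed.

(** This identifies a mate from the side of coevaluations, where for a tensor product of
    objects the composite is straightened one contraction at a time. *)
Lemma mate_coev w x (f : hom (w ⊗ x) 𝟙) (g : hom 𝟙 (x ⊗ w)) :
  (forall z, (idm x ⊠ cap f z) ∘ cup g (x ⊗ z) = idm _) ->
  (idm x ⊠ mate f) ∘ g = coev x.
Proof.
move=> zg; apply: cup_inj; rewrite cup_tens mate_whisk tens_compr -compmA cup_nat.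
by rewrite compmA zg compm_idl.
Qed.

Lemma ev_dualm x y (f : hom x y) :
  ev x ∘ (dualm f ⊠ idm x) = ev y ∘ (idm _ ⊠ f).
Proof. exact: ev_mate. Qed.
Lemma coev_dualm x y (f : hom x y) :
  (idm y ⊠ dualm f) ∘ coev y = (f ⊠ idm _) ∘ coev x.
Proof.
apply: cup_inj; rewrite !cup_tens tensm_id mate_whisk tens_compr -compmA cup_nat compmA.
by rewrite cap_tens tens_compr -!compmA (comp22 (cup_nat _ _)) (comp20 (cap_cup_obj _ _)).
Qed.

Lemma mateZ w x a (f : hom (w ⊗ x) 𝟙) : mate (a *: f) = a *: mate f.
Proof. by rewrite /mate tensZm !(compmZ, compZm). Qed.
Lemma mate_ev x : mate (ev x) = idm (dualo x).
Proof. exact: zigzag_dual. Qed.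
Lemma dualm_id x : dualm (idm x) = idm (dualo x).
Proof. by rewrite /dualm tensm_id compm_idr mate_ev. Qed.
Lemma dualmZ x y a (f : hom x y) : dualm (a *: f) = a *: dualm f.
Proof. by rewrite /dualm tensmZ compmZ mateZ. Qed.
Lemma mate_evK w x (f : hom w (dualo x)) : mate (ev x ∘ (f ⊠ idm x)) = f.
Proof.
apply: tens1_inj; rewrite mate_whisk cap_tens tensm_id -compmA interchange.
by rewrite (comp20 (cap_cup_dual _ _)).
Qed.
Lemma dualm_comp x y z (g : hom y z) (f : hom x y) : dualm (g ∘ f) = dualm f ∘ dualm g.
Proof.
rewrite -[RHS]mate_evK tens_compl compmA ev_dualm -compmA -interchange compmA ev_dualm.
by rewrite -compmA -tens_compr.
Qed.

(** If the dual of x is a zero object, then so is x, since the zigzag factors idm x through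
    it. *)
Lemma idm_dual0 x : idm (dualo x) = 0 -> idm x = 0.
Proof.
move=> e; rewrite -[LHS]zigzag_obj; have -> : ev x = 0.
  by rewrite -[LHS]compm_idr -tensm_id e tens0m compm0.
by rewrite tensm0 compm0 !comp0m.
Qed.

(** The nested evaluation and coevaluation, for which dualo y ⊗ dualo x is a dual of x ⊗ y. *)
Definition ev2 x y : hom ((dualo y ⊗ dualo x) ⊗ (x ⊗ y)) 𝟙 :=
  ev y ∘ (idm (dualo y) ⊠ cap (ev x) y) ∘ assoc (dualo y) (dualo x) (x ⊗ y).
Definition coev2 x y : hom 𝟙 ((x ⊗ y) ⊗ (dualo y ⊗ dualo x)) :=
  assocV x y (dualo y ⊗ dualo x) ∘ (idm x ⊠ cup (coev y) (dualo x)) ∘ coev x.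

Lemma dual_tensE x y : dual_tens x y = mate (ev2 x y).
Proof. by rewrite /ev2 capE. Qed.

(** The nested pair satisfies the zigzag identity: both inner contractions straighten, one
    after the other. *)
Lemma coev_tens x y : coev (x ⊗ y) = (idm _ ⊠ dual_tens x y) ∘ coev2 x y.
Proof.
rewrite dual_tensE; symmetry; apply: mate_coev => z.
apply: (inv_inj (assoc_iso x y z)); rewrite compmA -tensm_id assoc_nat -compmA cup_nested.
rewrite /ev2 cap_nested !tens_compr -!compmA.
rewrite (comp20 (tens_invr _ (tens_invr _ (assocVK _ _ _)))) (comp22 (cup_nat_r _ _ _)) cup_nat.
rewrite (comp22 (cup_nat_r _ _ _)) (comp20 (cap_cup_obj _ _)).
rewrite (comp20 (tens_invr _ (cap_cup_obj _ _))).
by rewrite compm_idr.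
Qed.
End Rigid.

Section Pivotal.
Variables (K : fieldType) (C : pivcat K).
Implicit Types u v w x y z : C.

(** The evaluation of x against its dual in the other order, which the pivotal structure
    provides. It is locked for the same reason as cap. *)
Definition evp x : hom (x ⊗ dualo x) 𝟙 :=
  locked (ev (dualo x) ∘ (piv x ⊠ idm (dualo x))).
Lemma evpE x : evp x = ev (dualo x) ∘ (piv x ⊠ idm (dualo x)).
Proof. by rewrite /evp -lock. Qed.

(** The pivotal trace, kept as an endomorphism of the unit object. *)
Definition trace_mor x (f : hom x x) : hom (𝟙 : C) 𝟙 := evp x ∘ (f ⊠ idm _) ∘ coev x.

Lemma trace_mor_id x : trace_mor (idm x) = pdim_mor x.
Proof. by rewrite /trace_mor tensm_id compm_idr evpE. Qed.

Lemma trace_morZ x a (f : hom x x) : trace_mor (a *: f) = a *: trace_mor f.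
Proof. by rewrite /trace_mor tensZm compmZ compZm. Qed.
Lemma trace_mor_sum (T : finType) x (f : T -> hom x x) :
  trace_mor (\sum_t f t) = \sum_t trace_mor (f t).
Proof.
by rewrite /trace_mor (lin_sum (tensm_linear_l _)) compm_sumr compm_suml.
Qed.

(** A morphism slides around the loop: through the cup it turns into its dual, and through
    the cap it comes back because the pivotal structure is natural. *)
Lemma trace_mor_cyclic x y (f : hom y x) (g : hom x y) : trace_mor (f ∘ g) = trace_mor (g ∘ f).
Proof.
have evp_dual : evp x ∘ (f ⊠ idm _) = evp y ∘ (idm _ ⊠ dualm f).
  rewrite !evpE -!compmA -tens_compl piv_nat tens_compl (comp22 (ev_dualm _)).
  by rewrite interchange.
rewrite /trace_mor [in LHS]tens_compl compmA evp_dual -!compmA.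
rewrite -(comp22 (interchange _ _)) coev_dualm.
by rewrite (comp21 (esym (tens_compl _ _ _))) compmA.
Qed.

(** The partial trace over the strand w. It is locked for the same reason as cap. *)
Definition ptrace w x y (f : hom (x ⊗ w) (y ⊗ w)) : hom x y :=
  locked (runit y ∘ (idm y ⊠ evp w) ∘ assoc y w (dualo w) ∘ (f ⊠ idm _)
    ∘ assocV x w (dualo w) ∘ (idm x ⊠ coev w) ∘ runitV x).

Lemma ptrace_whisk w x y (f : hom (x ⊗ w) (y ⊗ w)) z :
  ptrace f ⊠ idm z =
  (idm y ⊠ cap (evp w) z) ∘ hat f (dualo w ⊗ z) ∘ (idm x ⊠ cup (coev w) z).
Proof.
rewrite /ptrace -lock capE cupE hatE !tens_compl !tens_compr -triangle -triangleV -!compmA.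
rewrite (comp22 (assoc_nat _ _ _)) -(comp22 (assocV_nat _ _ _)).
rewrite (comp22 (pentagon_tens_l _ _ _ _)) -!compmA.
rewrite (comp22 (assoc_nat _ _ _)) tensm_id (comp31 (pentagonV_tens_mid _ _ _ _)).
by rewrite -!compmA.
Qed.

Lemma ptrace_nat w x y x' y' (f : hom (x ⊗ w) (y ⊗ w)) (g : hom y y') (h : hom x' x) :
  ptrace ((g ⊠ idm w) ∘ f ∘ (h ⊠ idm w)) = g ∘ ptrace f ∘ h.
Proof.
apply: tens1_inj; rewrite !tens_compl !ptrace_whisk !hat_comp !hat_tens !tensm_id -!compmA.
by rewrite interchange (comp22 (interchange _ _)).
Qed.

Lemma ptrace_superpose y w x x' (f : hom (x ⊗ w) (x' ⊗ w)) :
  ptrace (assocV y x' w ∘ (idm y ⊠ f) ∘ assoc y x w) = idm y ⊠ ptrace f.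
Proof.
apply: tens1_inj; apply: (inv_inj (assoc_iso _ _ _)).
rewrite assoc_nat !ptrace_whisk.
have := hat_whisk y f (dualo w ⊗ 𝟙); set t := hat (_ ∘ _ ∘ _) _ => ht.
rewrite !tens_compr -!tensm_id -!compmA.
by rewrite (comp22 (assoc_nat _ _ _)) (comp22 ht) assoc_nat.
Qed.

(** Here monoidality of the pivotal structure enters: it says that evp of a tensor product
    is nested as well. *)
Lemma evp_tens x y : evp (x ⊗ y) ∘ (idm _ ⊠ dual_tens x y) =
  ev2 (dualo y) (dualo x) ∘ ((piv x ⊠ piv y) ⊠ idm _).
Proof.
rewrite !evpE -compmA interchange compmA -ev_dualm -compmA -tens_compl piv_tens.
by rewrite tens_compl compmA dual_tensE ev_mate.
Qed.

Lemma cap_evp_tens x y z :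
  cap (ev2 (dualo y) (dualo x) ∘ ((piv x ⊠ piv y) ⊠ idm _)) z =
  cap (evp x) z ∘ (idm x ⊠ cap (evp y) (dualo x ⊗ z))
    ∘ (idm x ⊠ (idm y ⊠ assoc _ _ z)) ∘ assoc _ _ _.
Proof.
rewrite cap_tens cap_nested tensm_id !evpE !cap_tens !tensm_id tens_compr -!compmA.
rewrite assoc_nat (comp22 (interchange _ _)).
rewrite !(comp21 (esym (tensm_comp _ _ _ _))) !compm_idl !compm_idr.
by rewrite -!compmA -interchange.
Qed.

(** Tracing over x ⊗ w is tracing over w and then over x, since the cup and the cap of x ⊗ w
    are nested and the comparison isomorphism dual_tens cancels between them. *)
Lemma trace_mor_ptrace x w (f : hom (x ⊗ w) (x ⊗ w)) : trace_mor f = trace_mor (ptrace f).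
Proof.
rewrite /trace_mor coev_tens -!compmA (comp22 (interchange _ _)) compmA evp_tens.
apply: cap_cup_inj; rewrite cap_evp_tens cup_tens tensm_id.
have := cup_nested (coev w) (coev x) 𝟙; rewrite -/(coev2 x w) => hc.
rewrite cup_tens tensm_id ptrace_whisk -!compmA.
(* Insert an associator and its inverse to recognise the nested cup and hat f. *)
rewrite -[f ⊠ _]compm_idr -(assocK x w _) -!compmA hc.
rewrite (comp31 (esym (hatE f _))) -(comp22 (hat_nat _ _)) -!compmA.
by rewrite (comp20 (tens_invr _ (tens_invr _ (assocVK _ _ _)))).
Qed.
End Pivotal.

(** * Braiding and twist *)

Section Braided.
Variables (K : fieldType) (C : brfusion K).
Implicit Types u v w x y z : C.

Lemma braidK x y : braidV x y ∘ braid x y = idm _.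
Proof. by case: (braid_iso x y). Qed.

(** By naturality and the hexagon, braiding x past 𝟙 ⊗ 𝟙 can be computed in two ways;
    cancelling one braiding leaves the triangle identity. *)
Lemma braid_unit_r x : lunit x ∘ braid x 𝟙 = runit x.
Proof.
apply: tens1_inj; rewrite -triangle.
apply: (inv_injr (inv_sym (assoc_iso x 𝟙 𝟙))); apply: (inv_inj (braid_iso x 𝟙)).
rewrite -[in RHS]compmA assocVK compm_idr braid_nat hexagon_r -!compmA.
rewrite -lunit_tens -!compmA (comp20 (assocVK _ _ _)) (comp22 (lunit_nat _)).
by rewrite (comp21 (lunit_tens _ _)) (comp21 (esym (tens_compl _ _ _))).
Qed.

Lemma braid_unit_l x : runit x ∘ braid 𝟙 x = lunit x.
Proof.
apply: tens1l_inj; rewrite tens_compr.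
apply: (inv_injr (assoc_iso 𝟙 𝟙 x)); apply: (inv_inj (braid_iso 𝟙 x)).
rewrite triangle braid_nat hexagon_l -!compmA.
rewrite (comp21 (runit_tens _ _)) (comp22 (runit_nat _)) -(comp21 (runit_tens _ _)).
by rewrite (comp20 (assocVK _ _ _)).
Qed.

Lemma braidV_unit_r x : braid x 𝟙 ∘ runitV x = lunitV x.
Proof.
apply: (inv_inj (lunit_iso x)); by rewrite compmA braid_unit_r lunitVK runitVK.
Qed.
Lemma braidV_unit_l x : braid 𝟙 x ∘ lunitV x = runitV x.
Proof.
apply: (inv_inj (runit_iso x)); by rewrite compmA braid_unit_l lunitVK runitVK.
Qed.

(** The hexagon in whiskered form: passing x in front of u ⊗ v is passing it in front of u
    and then of v. *)
Lemma hat_braid_r x u v z :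
  assoc u v (x ⊗ z) ∘ hat (braid x (u ⊗ v)) z =
  (idm u ⊠ hat (braid x v) z) ∘ hat (braid x u) (v ⊗ z) ∘ (idm x ⊠ assoc u v z).
Proof.
rewrite !hatE hexagon_r !tens_compl !tens_compr -!compmA (comp31 (pentagonV_tens_r _ _ _ _)).
rewrite -!compmA (comp22 (assoc_nat _ _ _)) (comp22 (pentagon_tens_l _ _ _ _)) -!compmA.
by rewrite (comp22 (assoc_nat _ _ _)) (comp3r (pentagonV_tens_mid _ _ _ _)) tensm_id.
Qed.

Lemma hat_braid_l u v y z :
  (idm y ⊠ assoc u v z) ∘ hat (braid (u ⊗ v) y) z =
  hat (braid u y) (v ⊗ z) ∘ (idm u ⊠ hat (braid v y) z) ∘ assoc u v (y ⊗ z).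
Proof.
rewrite !hatE hexagon_l !tens_compl !tens_compr -!compmA (comp31 (esym (pentagon _ _ _ _))).
rewrite -!compmA (comp22 (assoc_nat _ _ _)) (comp22 (pentagonV_tens_l _ _ _ _)) -!compmA.
by rewrite (comp22 (assoc_nat _ _ _)) (comp3r (pentagon_tens _ _ _ _)) tensm_id.
Qed.

Lemma hat_braid_unit_r x z : hat (braid x 𝟙) z ∘ (idm x ⊠ lunitV z) = lunitV (x ⊗ z).
Proof.
rewrite hatE -!compmA triangleV -tens_compl braidV_unit_r -lunitV_tens.
by rewrite (comp20 (assocVK _ _ _)).
Qed.
Lemma hat_braid_unit_l x z : hat (braid 𝟙 x) z ∘ lunitV (x ⊗ z) = idm x ⊠ lunitV z.
Proof.
rewrite hatE -!compmA lunitV_tens -tens_compl braidV_unit_l -triangleV.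
by rewrite (comp20 (assocVK _ _ _)).
Qed.

(** A strand x passes freely behind or in front of a cup: the pair (u, v) is created from
    the unit object, with which x braids trivially. *)
Lemma hat_braid_cup x u v (g : hom 𝟙 (u ⊗ v)) z :
  (idm u ⊠ hat (braid x v) z) ∘ hat (braid x u) (v ⊗ z) ∘ (idm x ⊠ cup g z) = cup g (x ⊗ z).
Proof.
rewrite !cupE !tens_compr !compmA -hat_braid_r -!compmA; congr (_ ∘ _).
rewrite -(hat_tens (idm x) g) (comp21 (esym (hat_comp _ _ _))) braid_nat hat_comp -compmA.
by rewrite hat_braid_unit_r hat_tens tensm_id.
Qed.

Lemma hat_cup_braid u v y (g : hom 𝟙 (u ⊗ v)) z :
  hat (braid u y) (v ⊗ z) ∘ (idm u ⊠ hat (braid v y) z) ∘ cup g (y ⊗ z) = idm y ⊠ cup g z.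
Proof.
rewrite !cupE !compmA -hat_braid_l -!compmA -(tensm_id y z) -(hat_tens g (idm y)).
rewrite (comp21 (esym (hat_comp _ _ _))) braid_nat hat_comp -compmA.
by rewrite hat_braid_unit_l hat_tens !tens_compr !compmA.
Qed.

Lemma braidV_nat x y x' y' (f : hom x x') (g : hom y y') :
  braidV y' x' ∘ (f ⊠ g) = (g ⊠ f) ∘ braidV y x.
Proof. exact: inv_square (braid_iso _ _) (braid_iso _ _) (braid_nat _ _). Qed.

Definition dbraid x y : hom (x ⊗ y) (x ⊗ y) := braid y x ∘ braid x y.

Lemma dbraid_nat x y x' y' (f : hom x x') (g : hom y y') :
  dbraid x' y' ∘ (f ⊠ g) = (f ⊠ g) ∘ dbraid x y.
Proof. by rewrite /dbraid -!compmA braid_nat !compmA braid_nat. Qed.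

(** The strand a passes b, encircles c and returns past b. *)
Lemma dbraid_tens_r a b c :
  dbraid a (b ⊗ c) =
  assoc a b c ∘ ((braid b a ⊠ idm c)
    ∘ (assocV b a c ∘ (idm b ⊠ dbraid a c) ∘ assoc b a c) ∘ (braid a b ⊠ idm c)) ∘ assocV a b c.
Proof.
by rewrite /dbraid hexagon_r hexagon_l tens_compr -!compmA (comp20 (assocVK _ _ _)).
Qed.

(** On three strands l, a, a the left side is the braid word s1 s2 s2 s1 s2, which the braid
    relation turns into the word s1 s1 s2 s1 s1 on the right. There s2 occurs only once, so
    that tracing over the last strand removes it by yanking. *)
Lemma dbraid_braid l a :
  dbraid l (a ⊗ a) ∘ (idm l ⊠ braid a a) =
  assoc l a a ∘ ((dbraid l a ⊠ idm a) ∘ (assocV l a a ∘ (idm l ⊠ braid a a) ∘ assoc l a a)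
    ∘ (dbraid l a ⊠ idm a)) ∘ assocV l a a.
Proof.
(* The braid relation for strands a, l, a: slide the crossing of l and a through a. *)
have yb : (idm a ⊠ braid a l) ∘ assoc a a l ∘ (braid a a ⊠ idm l) ∘ assocV a a l
    ∘ (idm a ⊠ braid l a) =
  assoc a l a ∘ (braid l a ⊠ idm a) ∘ assocV l a a ∘ (idm l ⊠ braid a a) ∘ assoc l a a
    ∘ (braid a l ⊠ idm a) ∘ assocV a l a.
  transitivity (assoc a l a ∘ braid a (a ⊗ l) ∘ (idm a ⊠ braid l a)).
    by rewrite hexagon_r -!compmA (comp20 (assocVK _ _ _)).
  by rewrite -compmA braid_nat hexagon_r -!compmA.
rewrite /dbraid -compmA braid_nat hexagon_r hexagon_l !tens_compl.
transitivity (assoc l a a ∘ (braid a l ⊠ idm a) ∘ assocV a l a ∘ ((idm a ⊠ braid a l)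
    ∘ assoc a a l ∘ (braid a a ⊠ idm l) ∘ assocV a a l ∘ (idm a ⊠ braid l a))
    ∘ assoc a l a ∘ (braid l a ⊠ idm a) ∘ assocV l a a); first by rewrite !compmA.
by rewrite yb -!compmA !(comp20 (assocK _ _ _)).
Qed.
End Braided.

Section Premodular.
Variables (K : fieldType) (C : premodular K).
Implicit Types u v w x y z a : C.

Lemma twist_dbraid x y : twist (x ⊗ y) = (twist x ⊠ twist y) ∘ dbraid x y.
Proof. by rewrite twist_tens compmA. Qed.

(** The defining relation between the pivotal structure and the twist, seen on evaluations. *)
Lemma evp_twist x : evp x = ev x ∘ braid x (dualo x) ∘ (twist x ⊠ idm _).
Proof. by rewrite evpE piv_twist tens_compl compmA ev_mate. Qed.

(** The braiding of 𝟙 with itself is trivial, so the twist of 𝟙 is idempotent; it is also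
    invertible. *)
Lemma twist_unit : twist 𝟙 = idm (𝟙 : C).
Proof.
have b1 : braid 𝟙 𝟙 = idm (𝟙 ⊗ 𝟙 : C).
  by apply: (inv_inj (lunit_iso _)); rewrite braid_unit_r lunit_unit compm_idr.
have [t tK] := twist_iso (𝟙 : C).
apply: (inv_inj tK); apply: (inv_injr (lunit_iso _)).
rewrite compm_idr [RHS]twist_nat twist_dbraid /dbraid b1 compm_idl compm_idr tens_split.
by rewrite compmA [in RHS]lunit_unit runit_nat -lunit_unit -[in RHS]compmA lunit_nat compmA.
Qed.

(** The evaluation absorbs the twist of dualo x ⊗ x, so under it the double braiding of x
    with its dual amounts to two inverse twists of x. This trades the braiding in evp_twist
    for the inverse of the opposite braiding. *)
Lemma ev_braidV x : ev x ∘ braidV (dualo x) x = evp x ∘ (twist x ⊠ idm _).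
Proof.
apply: (inv_injr (braid_iso (dualo x) x)).
rewrite -compmA braidK compm_idr evp_twist -!compmA -!braid_nat.
rewrite -[LHS]compm_idl -[idm 𝟙]twist_unit twist_nat twist_dbraid tens_split.
rewrite -!compmA -twist_dual (comp22 (ev_dualm _)).
by rewrite -(comp22 (braid_nat _ _)) -dbraid_nat -(comp22 (dbraid_nat _ _)) /dbraid -!compmA.
Qed.

(** Yanking. Write evp with the braiding and the twist; the strand x then crosses both legs
    of the cup and comes free of it, leaving a zigzag and the twist. *)
Lemma ptrace_braid x : ptrace (braid x x) = twist x.
Proof.
apply: tens1_inj; rewrite ptrace_whisk evp_twist cap_tens cap_hat tensm_id !tens_compr -!compmA.
rewrite -(hat_tens (idm x) (twist x)) (comp21 (esym (hat_comp _ _ _))) -braid_nat.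
rewrite hat_comp hat_tens tensm_id -!compmA interchange (comp31 (hat_braid_cup _ _ _)).
by rewrite (comp20 (cap_cup_obj _ _)).
Qed.

(** The pivotal evaluation and coevaluation form a duality on the other side. *)
Lemma cap_cup_piv x z : cap (evp x) (x ⊗ z) ∘ (idm x ⊠ cup (coev_piv x) z) = idm _.
Proof.
have [e1 e2] := piv_iso x.
rewrite evpE cap_tens tensm_id /coev_piv cup_tens tens_compr -!compmA.
rewrite (comp22 (interchange _ _)) (comp22 (cap_nat _ _)) interchange.
by rewrite (comp20 (cap_cup_dual _ _)) -tens_compl e1 tensm_id.
Qed.

(** The yanking on the other side, where the loop lies to the left of the strand. *)
Lemma braid_curl a z :
  cap (ev a) (a ⊗ z) ∘ (idm _ ⊠ hat (braid a a) z) ∘ cup (coev_piv a) (a ⊗ z) = twist a ⊠ idm z.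
Proof.
have h := hat_cup_braid a (coev_piv a) z.
rewrite -compmA; set r := _ ∘ cup _ _.
have -> : r = hat (braidV (dualo a) a) (a ⊗ z) ∘ (idm a ⊠ cup (coev_piv a) z).
  by rewrite -h -compmA (comp20 _) // -hat_comp braidK -tensm_id hat_tens !tensm_id.
rewrite compmA -cap_hat ev_braidV cap_tens tensm_id -compmA interchange.
by rewrite (comp20 (cap_cup_piv _ _)).
Qed.

(** By naturality of the half braiding f moves to the top. What remains on a ⊗ a is a pair
    (dualo a, a) created at the right and pulled around both strands; sliding it to the left
    instead makes its leg a cross the two strands, and the cap then closes dualo a against
    the first of them. This closing is a curl, and the crossing with the second strand is
    the braiding. *)
Lemma FS_op21E a c (f : hom c (a ⊗ a)) :
  @FS_op21 K C (center_embed c) a f = braid a a ∘ (twist a ⊠ idm a) ∘ f.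
Proof.
(* The pair created at the right of a ⊗ a may as well be created at its left. *)
have slide : (braidV (dualo a) (a ⊗ a) ⊠ idm a) ∘ assocV _ _ _
    ∘ (idm (a ⊗ a) ⊠ coev_piv a) ∘ runitV _
  = assocV _ _ _ ∘ (idm (dualo a) ⊠ braid a (a ⊗ a)) ∘ cup (coev_piv a) (a ⊗ a).
  rewrite -braidV_unit_l -!compmA (comp22 (esym (braid_nat _ _))) hexagon_l -!compmA.
  by rewrite (comp20 (assocK _ _ _)) (comp20 (tens_invl _ (braidK _ _))) cupE -!compmA.
transitivity (cap (ev a) (a ⊗ a) ∘ (idm _ ⊠ (assoc a a a ∘ braid a (a ⊗ a)))
    ∘ cup (coev_piv a) (a ⊗ a) ∘ f).
  have nat : ((idm (dualo a) ⊠ f) ⊠ idm a) ∘ (braidV (dualo a) c ⊠ idm a)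
    = (braidV (dualo a) (a ⊗ a) ⊠ idm a) ∘ ((f ⊠ idm (dualo a)) ⊠ idm a).
    by rewrite -!tens_compl braidV_nat.
  rewrite /FS_op21 /= -!compmA (comp22 nat) -(comp22 (assocV_nat _ _ _)) tensm_id.
  rewrite (comp22 (interchange _ _)) -runitV_nat tens_compr -!compmA.
  have := slide; move/(congr1 (fun t => t ∘ f)); rewrite -!compmA => ->.
  by rewrite -(comp22 (cap_whisk _ _ _)) capE !tens_compl -!compmA.
congr (_ ∘ f).
have -> : assoc a a a ∘ braid a (a ⊗ a) = (idm a ⊠ braid a a) ∘ hat (braid a a) a.
  by rewrite hexagon_r hatE -!compmA (comp20 (assocVK _ _ _)).
by rewrite tens_compr compmA cap_nat -!compmA (comp3r (braid_curl _ _)).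
Qed.
End Premodular.

(** * Simple objects and resolutions of the identity *)

Section Schur.
Variables (K : closedFieldType) (C : lincat K).
Implicit Types x y : C.

Lemma simple_id_neq0 x : is_simple x -> idm x != 0.
Proof.
case=> nz _; apply/eqP => e; apply: nz => y; split=> f.
  by rewrite -[f]compm_idl e comp0m.
by rewrite -[f]compm_idr e compm0.
Qed.

(** The kernel of f is a subobject of x, hence zero as f is nonzero, so that f is mono; as y
    is simple, f is then an isomorphism. *)
Lemma schur_iso x y (f : hom x y) : is_abelian C -> is_simple x -> is_simple y ->
  f != 0 -> is_iso f.
Proof.
move=> ab [nx sx] [ny sy] fn0.
have [k [i [fi0 ku]]] := ab_kernel ab f.
have mono_i : is_mono i.
  move=> w g h e; have [t [_ tu]] : exists! t : hom w k, i ∘ t = i ∘ g.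
    by apply: ku; rewrite compmA fi0 comp0m.
  by rewrite -(tu g) // -(tu h).
have fmono : is_mono f -> is_iso f by move=> /sy [zx|//]; case: (nx zx).
case: (sx _ _ mono_i) => [zk|[j [_ ij]]]; last first.
  by case/eqP: fn0; rewrite -[f]compm_idr -ij compmA fi0 comp0m.
apply: fmono => w g h e.
have [t [it _]] : exists! t : hom w k, i ∘ t = g - h.
  by apply: ku; rewrite (linB (compm_linear_r f)) e subrr.
by apply/eqP; rewrite -subr_eq0 -it (proj1 (zk w) t) compm0.
Qed.

Lemma scalar_of_linear x : linear (@scalar_of K C x : _ -> K^o).
Proof. by move=> a f g; rewrite /scalar_of linearP. Qed.

Lemma scalar_ofZ x a : is_simple x -> scalar_of (a *: idm x) = a.
Proof.
move=> sx; rewrite /scalar_of linearZ /=.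
have fr : free [tuple idm x] by rewrite seq1_free simple_id_neq0.
by have := coord_free ord0 ord0 fr; rewrite /= => ->; rewrite mulr1.
Qed.

(** Composition with f has an eigenvalue on the space of endomorphisms, and f minus this
    eigenvalue is not invertible, hence zero. *)
Lemma schur_scalar x (f : hom x x) : is_abelian C -> is_simple x -> f = scalar_of f *: idm x.
Proof.
move=> ab sx; have idn0 := simple_id_neq0 sx.
have [a [v [vn0 fv]]] := eigenvector_exists (compm_linear_r f) idn0.
suff fE : f = a *: idm x by rewrite {2}fE scalar_ofZ.
apply/eqP; rewrite -subr_eq0; apply/negPn/negP => /(schur_iso ab sx sx)[g [gK _]].
case/eqP: vn0; rewrite -[v]compm_idl -gK -compmA compBm fv compZm compm_idl subrr.
by rewrite compm0.
Qed.
End Schur.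

Section Frames.
Variables (K : numClosedFieldType) (C : premodular K) (I : finType) (J : irrset C I).
Implicit Types (x y : C) (a b c e : I).

Let ab : is_abelian C := fus_abelian C.
Let sJ := irr_simple J.

Lemma end_scalar c (f : hom (J c) (J c)) : f = scalar_of f *: idm _.
Proof. exact: schur_scalar. Qed.

Lemma hom_neq0 a c : a != c -> forall f : hom (J a) (J c), f = 0.
Proof.
move=> ac f; apply/eqP; apply: contraNT ac => /(schur_iso ab (sJ a) (sJ c)) hf.
by apply/eqP; apply: (@irr_inj _ _ _ J); exists f.
Qed.

(** A resolution of the identity of x through the simple objects. Padding with zero maps
    makes n independent of c, and the sum formula alone yields the traces and dimensions
    below. *)
Definition is_frame x n (p : forall c, 'I_n -> hom x (J c)) (i : forall c, 'I_n -> hom (J c) x) :=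
  \sum_c \sum_k i c k ∘ p c k = idm x.

(** Compose a decomposition of x into simple objects with isomorphisms to the
    representatives J c; a summand contributes zero maps for all c but one. *)
Lemma frame_exists x : exists n p i, @is_frame x n p i.
Proof.
have [n [s [ss [i [p [_ _ sum1]]]]]] := fus_semisimple x.
have res k : exists (pq : (forall c, hom (s k) (J c)) * (forall c, hom (J c) (s k))),
    \sum_c pq.2 c ∘ pq.1 c = idm (s k).
  have [c0 [u [v [vu _]]]] := irr_complete J (ss k).
  exists (fun c => match pselect (c0 = c) with
       left e => eq_rect c0 (fun c => hom (s k) (J c)) u c e | right _ => 0 end,
     fun c => match pselect (c0 = c) with
       left e => eq_rect c0 (fun c => hom (J c) (s k)) v c e | right _ => 0 end).
  rewrite /= (bigD1 c0) //= big1 => [|c cn0]; last first.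
    by case: pselect => // e; [rewrite e eqxx in cn0 | rewrite comp0m].
  by rewrite addr0; case: pselect => // e; rewrite (Prop_irrelevance e erefl).
pose pq k := sval (cid (res k)); have pqE k := svalP (cid (res k)).
exists n, (fun c k => (pq k).1 c ∘ p k), (fun c k => i k ∘ (pq k).2 c).
rewrite /is_frame exchange_big -[RHS]sum1; apply: eq_bigr => k _ /=.
rewrite -[p k in RHS]compm_idl -pqE -/(pq k) compm_suml compm_sumr.
by apply: eq_bigr => c _; rewrite !compmA.
Qed.

Section Frame.
Variables (x : C) (n : nat).
Variables (p : forall c, 'I_n -> hom x (J c)) (i : forall c, 'I_n -> hom (J c) x).
Hypothesis fr : is_frame p i.

Lemma frame_to c (q : hom x (J c)) : q = \sum_k scalar_of (q ∘ i c k) *: p c k.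
Proof.
rewrite -[LHS]compm_idr -fr compm_sumr (bigD1 c) //= [X in _ + X]big1 ?addr0 => [|e ec].
  rewrite compm_sumr; apply: eq_bigr => k _.
  by rewrite compmA {1}(end_scalar (q ∘ i c k)) compZm compm_idl.
rewrite compm_sumr; apply: big1 => k _.
by rewrite compmA (hom_neq0 ec (q ∘ i e k)) comp0m.
Qed.

Lemma frame_from c (r : hom (J c) x) : r = \sum_k scalar_of (p c k ∘ r) *: i c k.
Proof.
rewrite -[LHS]compm_idl -fr compm_suml (bigD1 c) //= [X in _ + X]big1 ?addr0 => [|e ec].
  rewrite compm_suml; apply: eq_bigr => k _.
  by rewrite -compmA {1}(end_scalar (p c k ∘ r)) compmZ compm_idr.
rewrite compm_suml; apply: big1 => k _.
by rewrite -compmA eq_sym in ec *; rewrite (hom_neq0 ec (p e k ∘ r)) compm0.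
Qed.

Lemma trace_frame_to c (f : hom x x) :
  trace_of (fun q : hom x (J c) => q ∘ f) = \sum_k scalar_of (p c k ∘ f ∘ i c k).
Proof.
rewrite (trace_frame (v := p c) (phi := fun k q => scalar_of (q ∘ i c k))) //.
- exact: compm_linear_l.
- move=> k a q r; rewrite -scalar_of_linear; congr scalar_of; exact: compm_linear_l.
- exact: frame_to.
Qed.
Lemma trace_frame_from c (f : hom x x) :
  trace_of (fun r : hom (J c) x => f ∘ r) = \sum_k scalar_of (p c k ∘ f ∘ i c k).
Proof.
rewrite (trace_frame (v := i c) (phi := fun k r => scalar_of (p c k ∘ r))) //.
- by apply: eq_bigr => k _; rewrite compmA.
- exact: compm_linear_r.
- move=> k a q r; rewrite -scalar_of_linear; congr scalar_of; exact: compm_linear_r.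
- exact: frame_from.
Qed.
Lemma dim_frame_to c : (\dim {:hom x (J c)})%:R = \sum_k scalar_of (p c k ∘ i c k).
Proof.
apply: (dim_frame (phi := fun k q => scalar_of (q ∘ i c k))); last exact: frame_to.
move=> k a q r; rewrite -scalar_of_linear; congr scalar_of; exact: compm_linear_l.
Qed.
Lemma dim_frame_from c : (\dim {:hom (J c) x})%:R = \sum_k scalar_of (p c k ∘ i c k).
Proof.
apply: (dim_frame (phi := fun k r => scalar_of (p c k ∘ r))); last exact: frame_from.
move=> k a q r; rewrite -scalar_of_linear; congr scalar_of; exact: compm_linear_r.
Qed.
End Frame.

(** The dimensions agree as traces of the identity, both being the sum over k of the scalar
    by which p c k ∘ i c k acts on J c. *)
Lemma dim_hom_sym x c : \dim {:hom x (J c)} = \dim {:hom (J c) x}.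
Proof.
have [n [p [i fr]]] := frame_exists x.
by apply/eqP; rewrite -(eqr_nat K) (dim_frame_to fr) (dim_frame_from fr).
Qed.

Definition homtr x c (f : hom x x) : K := trace_of (fun q : hom x (J c) => q ∘ f).

(** The multiplicity spaces of maps to and from J c are dual to each other, so f has the
    same trace on both. *)
Lemma homtr_from x c (f : hom x x) : trace_of (fun r : hom (J c) x => f ∘ r) = homtr c f.
Proof.
have [n [p [i fr]]] := frame_exists x.
by rewrite /homtr (trace_frame_to fr) (trace_frame_from fr).
Qed.

Lemma trace_of_eq (V : vectType K) (f g : V -> V) : f =1 g -> trace_of f = trace_of g.
Proof. by move/funext ->. Qed.

Lemma homtr_scale x c (a : K) (f g : hom x x) :
  (forall q : hom x (J c), q ∘ f = a *: (q ∘ g)) -> homtr c f = a * homtr c g.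
Proof.
have [n [p [i fr]]] := frame_exists x.
rewrite /homtr !(trace_frame_to fr) => h; rewrite mulr_sumr; apply: eq_bigr => k _.
by rewrite h compZm; apply: (linZ (@scalar_of_linear _ _ _)).
Qed.

Lemma homtr_id x c : homtr c (idm x) = (\dim {:hom x (J c)})%:R.
Proof.
have [n [p [i fr]]] := frame_exists x.
by rewrite /homtr (trace_frame_to fr) (dim_frame_to fr); under eq_bigr => k _ do rewrite compm_idr.
Qed.

Definition ctrace x (f : hom x x) : K := scalar_of (trace_mor f).

Lemma unit_simple : is_simple (𝟙 : C). Proof. exact: fus_unit. Qed.
Lemma unit_scalar (f : hom (𝟙 : C) 𝟙) : f = scalar_of f *: idm 𝟙.
Proof. exact: schur_scalar ab unit_simple. Qed.
Lemma ctrace_id x : ctrace (idm x) = pdim x. Proof. by rewrite /ctrace trace_mor_id. Qed.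
Lemma ctraceZ x (a : K) (f : hom x x) : ctrace (a *: f) = a * ctrace f.
Proof. by rewrite /ctrace trace_morZ; apply: (linZ (@scalar_of_linear _ _ _)). Qed.
Lemma ctrace_sum (T : finType) x (f : T -> hom x x) : ctrace (\sum_t f t) = \sum_t ctrace (f t).
Proof. by rewrite /ctrace trace_mor_sum; apply: (lin_sum (@scalar_of_linear _ _ _)). Qed.
Lemma ctrace_cyclic x y (f : hom y x) (g : hom x y) : ctrace (f ∘ g) = ctrace (g ∘ f).
Proof. by rewrite /ctrace trace_mor_cyclic. Qed.
Lemma ctrace_ptrace x w (f : hom (x ⊗ w) (x ⊗ w)) : ctrace f = ctrace (ptrace f).
Proof. by rewrite /ctrace trace_mor_ptrace. Qed.

(** Insert a resolution of the identity and use cyclicity to move it onto the simple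
    objects. *)
Lemma ctrace_homtr x (f : hom x x) : ctrace f = \sum_c homtr c f * qdim J c.
Proof.
have [n [p [i fr]]] := frame_exists x.
rewrite -[f in LHS]compm_idr -fr compm_sumr ctrace_sum; apply: eq_bigr => c _.
rewrite /homtr (trace_frame_to fr) compm_sumr ctrace_sum mulr_suml.
apply: eq_bigr => k _; rewrite compmA ctrace_cyclic compmA.
by rewrite [X in ctrace X]end_scalar ctraceZ ctrace_id.
Qed.

Lemma ptrace_id x w : ptrace (idm (x ⊗ w)) = pdim w *: idm x.
Proof.
apply: tens1_inj; rewrite ptrace_whisk -(tensm_id x w) hat_tens !tensm_id compm_idr.
rewrite -tens_compr cap_cup tensZm tensm_id.
have -> : evp w ∘ coev w = pdim w *: idm 𝟙.
  by rewrite [LHS]unit_scalar /pdim -trace_mor_id /trace_mor tensm_id compm_idr.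
by rewrite tensZm tensm_id compmZ compm_idr compZm lunitVK tensmZ tensm_id.
Qed.

Lemma iso_pdim x y : isomorphic x y -> pdim x = pdim y.
Proof. by case=> f [g [gf fg]]; rewrite -!ctrace_id -gf -fg ctrace_cyclic. Qed.

Lemma iso_dim_l x y z : isomorphic x y -> \dim {:hom x z} = \dim {:hom y z}.
Proof.
case=> f [g [gf fg]]; apply/eqP; rewrite eqn_leq; apply/andP; split.
  apply: (leq_dim_inj (f := fun h : hom x z => h ∘ g) (compm_linear_l _)) => h e.
  by rewrite -[h]compm_idr -gf compmA e comp0m.
apply: (leq_dim_inj (f := fun h : hom y z => h ∘ f) (compm_linear_l _)) => h e.
by rewrite -[h]compm_idr -fg compmA e comp0m.
Qed.

Lemma iso_dim_r x y z : isomorphic x y -> \dim {:hom z x} = \dim {:hom z y}.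
Proof.
case=> f [g [gf fg]]; apply/eqP; rewrite eqn_leq; apply/andP; split.
  apply: (leq_dim_inj (f := fun h : hom z x => f ∘ h) (compm_linear_r _)) => h e.
  by rewrite -[h]compm_idl -gf -compmA e compm0.
apply: (leq_dim_inj (f := fun h : hom z y => g ∘ h) (compm_linear_r _)) => h e.
by rewrite -[h]compm_idl -fg -compmA e compm0.
Qed.

Lemma iso_tens x x' y y' : isomorphic x x' -> isomorphic y y' -> isomorphic (x ⊗ y) (x' ⊗ y').
Proof. by case=> f [f' e] [g [g' e']]; exists (f ⊠ g), (f' ⊠ g'); apply: inv_tens. Qed.
Lemma iso_refl x : isomorphic x x.
Proof. by exists (idm x), (idm x); apply: inv_id. Qed.

(** * Duals of simple objects and symmetries of fusion coefficients *)

(** The dual of g is an endomorphism of the double dual of J i, which is isomorphic to J i,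
    so it is a scalar; g is recovered as its double dual through the pivotal structure. *)
Lemma end_dual_scalar i (g : hom (dualo (J i)) (dualo (J i))) : exists a : K, g = a *: idm _.
Proof.
have [e1 e2] := piv_iso (J i).
pose h := pivV (J i) ∘ dualm g ∘ piv (J i); exists (scalar_of h).
have hE : dualm g = scalar_of h *: idm _.
  apply: (inv_injr (piv_iso (J i))); apply: (inv_inj (inv_sym (piv_iso (J i)))).
  by rewrite compmA -/h compZm compm_idl compmZ e1 -end_scalar.
apply: (inv_inj (piv_iso (dualo (J i)))).
by rewrite piv_nat hE dualmZ dualm_id compZm compm_idl compmZ compm_idr.
Qed.

(** Some term of a resolution of the identity of the dual is nonzero. Since all
    endomorphisms of the dual are scalars, that term is an isomorphism after scaling. *)
Lemma dual_idxP i : isomorphic (dualo (J i)) (J (dual_idx J i)).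
Proof.
rewrite /dual_idx; case: pickP => [j /asboolP //|none].
suff [j /asboolP hj] : exists j, isomorphic (dualo (J i)) (J j) by rewrite none in hj.
set D := dualo (J i); have [n [p [v fr]]] := frame_exists D.
have Dn0 : idm D <> 0.
  by move=> /idm_dual0 e; have := simple_id_neq0 (sJ i); rewrite e eqxx.
have [c [k vp]] : exists c k, v c k ∘ p c k != 0.
  apply: contrapT => no; apply: Dn0; rewrite -fr; apply: big1 => c _; apply: big1 => k _.
  by apply/eqP/negPn/negP => h; apply: no; exists c, k.
have [l le] := end_dual_scalar (v c k ∘ p c k).
have ln0 : l != 0 by apply: contraNneq vp => l0; rewrite le l0 scale0r.
exists c, (p c k), (l^-1 *: v c k); split.
  by rewrite compZm le scalerA mulVf // scale1r.
rewrite compmZ [p c k ∘ _]end_scalar; set m := scalar_of _.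
suff -> : m = l by rewrite scalerA mulVf // scale1r.
(* The two scalars agree because the square of v c k ∘ p c k can be computed in two ways. *)
have : (v c k ∘ p c k) ∘ (v c k ∘ p c k) = m *: (v c k ∘ p c k).
  by rewrite -compmA (compmA (p c k)) [p c k ∘ v c k]end_scalar -/m compZm compm_idl compmZ.
rewrite le compZm compm_idl !scalerA => /eqP; rewrite -subr_eq0 -scalerBl scaler_eq0.
rewrite -mulrBl mulf_eq0 (negPf ln0) orbF subr_eq0 => /orP[/eqP ->//|/eqP//].
Qed.

Lemma dual_idx_unique i j : isomorphic (dualo (J i)) (J j) -> dual_idx J i = j.
Proof.
move=> h; apply: (@irr_inj _ _ _ J); apply: isomorphic_trans h.
exact: isomorphic_sym (dual_idxP i).
Qed.

Lemma iso_dual x y : isomorphic x y -> isomorphic (dualo x) (dualo y).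
Proof.
by case=> f [g [gf fg]]; exists (dualm g), (dualm f); split; rewrite -dualm_comp ?gf ?fg dualm_id.
Qed.

Lemma dual_idxK i : dual_idx J (dual_idx J i) = i.
Proof.
apply: dual_idx_unique.
apply: isomorphic_trans (iso_dual (isomorphic_sym (dual_idxP i))) _.
by apply: isomorphic_sym; exists (piv (J i)), (pivV (J i)); apply: piv_iso.
Qed.

Lemma pdim_dual i : qdim J (dual_idx J i) = qdim J i.
Proof. by rewrite /qdim -(iso_pdim (dual_idxP i)) /pdim fus_spherical. Qed.

Lemma twist_irr c : twist (J c) = theta J c *: idm _.
Proof. exact: end_scalar. Qed.

Lemma theta_neq0 c : theta J c != 0.
Proof.
apply: contraNneq (simple_id_neq0 (sJ c)) => t0.
have [t [_ e]] := twist_iso (J c).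
by rewrite -e twist_irr t0 scale0r comp0m.
Qed.

(** The twist of a dual is the dual of the twist, which is the same scalar. *)
Lemma theta_dual i : theta J (dual_idx J i) = theta J i.
Proof.
have [f [g [gf fg]]] := dual_idxP i.
have e : theta J (dual_idx J i) *: idm _ = theta J i *: idm (J (dual_idx J i)).
  rewrite -twist_irr -[twist _]compm_idr -fg compmA twist_nat -twist_dual.
  by rewrite twist_irr dualmZ dualm_id compmZ compm_idr compZm fg.
by rewrite -[LHS](scalar_ofZ _ (sJ (dual_idx J i))) e scalar_ofZ.
Qed.

Lemma theta_unit : theta J (irr_unit J) = 1.
Proof.
by rewrite /theta irr_unitE twist_unit -[idm _]scale1r scalar_ofZ //; apply: unit_simple.
Qed.

Lemma fusNC a b c : fusN J a b c = fusN J b a c.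
Proof. by apply: iso_dim_l; exists (braid _ _), (braidV _ _); apply: braid_iso. Qed.

Lemma fusN_unit a c : fusN J a (irr_unit J) c = (a == c).
Proof.
rewrite /fusN irr_unitE.
rewrite (iso_dim_l (y := J a)); last by exists (runit _), (runitV _); apply: runit_iso.
case: (eqVneq a c) => [<-|/hom_neq0 h] /=.
  have -> : fullv = <[idm (J a)]>%VS.
    by apply/eqP; rewrite eqEsubv subvf andbT; apply/subvP => f _;
       rewrite [f]end_scalar memvZ ?memv_line.
  by rewrite dim_vline simple_id_neq0.
by apply/eqP; rewrite dimv_eq0 -subv0; apply/subvP => f _; rewrite (h f) mem0v.
Qed.

(** Bending the second strand of f down is injective because a zigzag bends it back. *)
Lemma bend_inj x y z (f : hom (x ⊗ y) z) :
  (f ⊠ idm (dualo y)) ∘ assocV x y (dualo y) ∘ (idm x ⊠ coev y) = 0 -> f = 0.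
Proof.
move=> e.
have h u : (f ⊠ idm (dualo y ⊗ u)) ∘ (assocV x y (dualo y ⊗ u) ∘ (idm x ⊠ cup (coev y) u)) = 0.
  rewrite cupE !tens_compr -!compmA (comp22 (esym (pentagonV_tens_mid _ _ _ _))) -!compmA.
  rewrite -(tensm_id (dualo y)) -(comp22 (assoc_nat _ _ _)) (comp22 (assocV_nat _ _ _)).
  have := congr1 (fun t => t ⊠ idm u) e; rewrite /= !tens_compl tens0m => /(comp31 (r := 0)) ->.
  by rewrite comp0m compm0.
apply: tens1_inj; rewrite tens0m; apply: (inv_injr (inv_sym (assoc_iso x y 𝟙))).
have := congr1 (fun t => (idm z ⊠ cap (ev y) 𝟙) ∘ t) (h (y ⊗ 𝟙)).
rewrite /= compm0 comp0m -(comp22 (interchange _ _)) -(tensm_id x y) -(comp22 (assocV_nat _ _ _)).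
by rewrite (tens_invr _ (cap_cup_obj _ _)) compm_idr.
Qed.

(** By bend_inj one coefficient is at most the other; bending twice gives the converse. *)
Lemma fusN_bend a b c : fusN J a b c = fusN J c (dual_idx J b) a.
Proof.
have le a' b' c' : (fusN J a' b' c' <= fusN J c' (dual_idx J b') a')%N.
  rewrite /fusN [X in (_ <= X)%N]dim_hom_sym.
  rewrite -(iso_dim_r _ (iso_tens (iso_refl (J c')) (dual_idxP b'))).
  rewrite -(iso_dim_l (x := J a' ⊗ 𝟙) (y := J a')); last first.
    by exists (runit _), (runitV _); apply: runit_iso.
  apply: (leq_dim_inj (f := fun f : hom (J a' ⊗ J b') (J c') =>
    (f ⊠ idm (dualo (J b'))) ∘ assocV _ _ _ ∘ (idm (J a') ⊠ coev (J b')))); last exact: bend_inj.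
  by move=> k f g; rewrite (tensm_linear_l _) (compm_linear_l _) (compm_linear_l _).
by apply/eqP; rewrite eqn_leq le -{2}[b]dual_idxK le.
Qed.
End Frames.

(** * Hopf links and the indicator *)

Section Modular.
Variables (K : numClosedFieldType) (C : premodular K) (I : finType) (J : irrset C I).
Implicit Types (x y : C) (a b c e i j k l : I).

Local Notation N := (fusN J).
Local Notation d := (qdim J).
Local Notation th := (theta J).
Local Notation "i ^*d" := (dual_idx J i) (at level 2, format "i ^*d").

Lemma fusN_dual_l i j k : N i^*d j k = N i k j.
Proof. by rewrite fusNC fusN_bend dual_idxK fusNC. Qed.
Lemma fusN_dual a b c : N a^*d b^*d c^*d = N a b c.
Proof. by rewrite fusN_dual_l fusNC fusN_dual_l -fusN_bend. Qed.

(** The Hopf link with components coloured a and b. *)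
Definition hopf a b : K := ctrace (dbraid (J a) (J b)).

Lemma dbraid_hom a b c (q : hom (J a ⊗ J b) (J c)) :
  q ∘ dbraid (J a) (J b) = (th c / (th a * th b)) *: q.
Proof.
have := twist_nat q; rewrite twist_dbraid !twist_irr.
rewrite compZm compm_idl tensZm tensmZ tensm_id !compZm !compmZ compm_idl => e.
rewrite -[LHS](scalerK (a := th a * th b)) ?mulf_neq0 ?theta_neq0 //.
by rewrite -!scalerA -e !scalerA mulrC.
Qed.

Lemma hopfE a b : hopf a b = \sum_c (N a b c)%:R * (th c / (th a * th b)) * d c.
Proof.
rewrite /hopf (ctrace_homtr J); apply: eq_bigr => c _; congr (_ * _).
rewrite (homtr_scale (a := th c / (th a * th b)) (g := idm _)) => [|q].
  by rewrite homtr_id mulrC.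
by rewrite dbraid_hom compm_idr.
Qed.

Lemma hopfC a b : hopf a b = hopf b a.
Proof. by rewrite /hopf /dbraid ctrace_cyclic. Qed.

Lemma hopf_unit a : hopf a (irr_unit J) = d a.
Proof.
rewrite hopfE (bigD1 a) //= big1 ?addr0 => [|c /negPf ca]; rewrite fusN_unit ?eqxx.
  by rewrite theta_unit mulr1 mul1r divff ?mul1r ?theta_neq0.
by rewrite eq_sym ca !mul0r.
Qed.

Lemma Smx_hopf i j : Smx J i j = hopf i^*d j.
Proof.
rewrite hopfE /Smx mulr_sumr; apply: eq_bigr => k _.
by rewrite theta_dual invfM; ring.
Qed.

Lemma ctrace_dbraid a x :
  ctrace (dbraid (J a) x) = \sum_e (\dim {:hom x (J e)})%:R * hopf a e.
Proof.
have [n [p [i fr]]] := frame_exists J x.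
rewrite -[dbraid _ _]compm_idr -tensm_id -fr tensm_sumr compm_sumr ctrace_sum.
apply: eq_bigr => e _.
rewrite (dim_frame_to fr) mulr_suml tensm_sumr compm_sumr ctrace_sum; apply: eq_bigr => k _.
rewrite tens_compr compmA ctrace_cyclic compmA -dbraid_nat -compmA -tens_compr.
by rewrite [p e k ∘ i e k in LHS]end_scalar tensmZ tensm_id compmZ compm_idr ctraceZ.
Qed.

(** The scalar by which a loop b acts on the strand a that it encircles. *)
Definition hopf_scalar a b : K := scalar_of (ptrace (dbraid (J a) (J b))).
Lemma ptrace_dbraid a b : ptrace (dbraid (J a) (J b)) = hopf_scalar a b *: idm _.
Proof. exact: end_scalar. Qed.
Lemma hopf_scalarE a b : hopf a b = hopf_scalar a b * d a.
Proof. by rewrite /hopf ctrace_ptrace ptrace_dbraid ctraceZ ctrace_id. Qed.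

(** Two loops b and c around a strand a act by the product of their scalars, and merge into
    one loop coloured by b ⊗ c. *)
Lemma hopf_mul a b c : hopf a b * hopf a c = d a * \sum_e (N b c e)%:R * hopf a e.
Proof.
rewrite -(ctrace_dbraid a (J b ⊗ J c)) dbraid_tens_r ctrace_cyclic compmA assocK compm_idl.
rewrite ctrace_ptrace ptrace_nat ptrace_superpose ptrace_dbraid.
rewrite tensmZ tensm_id compmZ compm_idr compZm ctraceZ.
rewrite (hopf_scalarE a c) (_ : ctrace (_ ∘ _) = hopf a b) //; ring.
Qed.

Lemma nu_homtr a c : nu J a c = th a * homtr J c (braid (J a) (J a)).
Proof.
rewrite /nu /nu21 -homtr_from.
have [n [p [i fr]]] := frame_exists J (J a ⊗ J a).
transitivity (trace_of (fun f : hom (J c) (J a ⊗ J a) => (th a *: braid (J a) (J a)) ∘ f)).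
  apply: trace_of_eq => f; rewrite FS_op21E twist_irr tensZm tensm_id compmZ compm_idr.
  by [].
rewrite !homtr_from; apply: homtr_scale => q; exact: compmZ.
Qed.

(** Both sides evaluate the link made of the closure of the braiding of a with itself and of
    a loop l around its two strands. On the left a ⊗ a is decomposed and l acts by a scalar
    on each constituent; on the right dbraid_braid and yanking leave a link of one strand l
    and one strand a. *)
Lemma link_sum a l :
  \sum_c nu J a c * hopf c l = \sum_k (N l a k)%:R * (th k ^+ 2 / th l ^+ 2) * d k.
Proof.
(* First, decompose a ⊗ a. *)
pose R := braid (J a) (J a).
transitivity (th a * ctrace ((R ⊠ idm (J l)) ∘ dbraid (J a ⊗ J a) (J l))).
  have e : (R ⊠ idm (J l)) ∘ dbraid (J a ⊗ J a) (J l) =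
    (R ⊠ idm (J l)) ∘ dbraid (J a ⊗ J a) (J l) ∘ (idm _ ⊠ idm _).
    by rewrite tensm_id compm_idr.
  rewrite e ctrace_ptrace ptrace_nat compm_idr (ctrace_homtr J) mulr_sumr; apply: eq_bigr => c _.
  rewrite (homtr_scale (a := hopf_scalar c l) (g := R)) => [|q].
    by rewrite nu_homtr hopf_scalarE; ring.
  have nat : q ∘ R ∘ ptrace (dbraid (J a ⊗ J a) (J l)) = ptrace (dbraid (J c) (J l)) ∘ (q ∘ R).
    rewrite -[LHS]compm_idr -ptrace_nat -dbraid_nat tensm_id compm_idr.
    by rewrite -[dbraid _ _ in LHS]compm_idl -tensm_id ptrace_nat compm_idl.
  by rewrite compmA nat ptrace_dbraid compZm compm_idl.
(* Second, move l to the first position by cyclicity and trace over the last strand a. *)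
rewrite /dbraid compmA ctrace_cyclic -braid_nat compmA -/(dbraid (J l) (J a ⊗ J a)) dbraid_braid.
rewrite ctrace_cyclic compmA assocK compm_idl ctrace_ptrace.
rewrite ptrace_nat ptrace_superpose ptrace_braid.
rewrite twist_irr tensmZ tensm_id compmZ compm_idr compZm ctraceZ mulrA (ctrace_homtr J) mulr_sumr.
apply: eq_bigr => k _; pose t := th k / (th l * th a).
rewrite (homtr_scale (a := t ^+ 2) (g := idm _)) => [|q].
  rewrite homtr_id -/(fusN J l a k) /t; have := theta_neq0 J a; have := theta_neq0 J l.
  by move=> ln an; field; rewrite ln an.
by rewrite compmA !dbraid_hom scalerA compm_idr.
Qed.
End Modular.

(** * Characters of the fusion ring and the S-matrix *)

Section Kernels.
Variables (K : fieldType) (I : finType) (F : I -> I -> K).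
Let M := \matrix_(i < #|I|, j < #|I|) F (enum_val i) (enum_val j).
Hypothesis uM : M \in unitmx.

Lemma unitmx_kernel (v : I -> K) : (forall i, \sum_j F i j * v j = 0) -> forall j, v j = 0.
Proof.
move=> h j; pose V := \col_k v (enum_val k) : 'cV[K]_#|I|.
have MV : M *m V = 0.
  apply/colP => k; rewrite !mxE -[RHS](h (enum_val k)) [RHS]big_enum_val.
  by apply: eq_bigr => m _; rewrite !mxE.
by have /colP/(_ (enum_rank j)) := mulKmx uM V; rewrite MV mulmx0 !mxE enum_rankK.
Qed.

Lemma unitmx_cokernel (v : I -> K) : (forall j, \sum_i v i * F i j = 0) -> forall i, v i = 0.
Proof.
move=> h j; pose V := \row_k v (enum_val k) : 'rV[K]_#|I|.
have MV : V *m M = 0.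
  apply/rowP => k; rewrite !mxE -[RHS](h (enum_val k)) [RHS]big_enum_val.
  by apply: eq_bigr => m _; rewrite !mxE.
by have /rowP/(_ (enum_rank j)) := mulmxK uM V; rewrite MV mul0mx !mxE enum_rankK.
Qed.
End Kernels.

Section FusionCharacters.
Variables (K : numClosedFieldType) (I : finType).
Variables (N : I -> I -> I -> nat) (du : I -> I).
Hypothesis N_du : forall i j k, N (du i) j k = N i k j.
Definition fusion_char (chi : I -> K) :=
  forall j k, chi j * chi k = \sum_l (N j k l)%:R * chi l.

(** Expand the sum of chi m * chi l * (psi l)^* in two ways, letting m act on chi or,
    transposed and conjugated, on psi. *)
Lemma char_product (chi psi : I -> K) m : fusion_char chi -> fusion_char psi ->
  chi m * (\sum_l chi l * (psi l)^*) = (psi (du m))^* * (\sum_l chi l * (psi l)^*).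
Proof.
move=> hc hp; rewrite !mulr_sumr.
under eq_bigr => l _ do rewrite mulrA hc mulr_suml.
rewrite exchange_big; apply: eq_bigr => k _ /=.
rewrite mulrCA -rmorphM hp rmorph_sum mulr_sumr; apply: eq_bigr => l _.
by rewrite rmorphM rmorph_nat N_du; ring.
Qed.

Lemma char_norm_neq0 (chi : I -> K) e : chi e != 0 -> \sum_l chi l * (chi l)^* != 0.
Proof.
move=> ce; rewrite gt_eqF // (bigD1 e) //= ltr_wpDr ?mul_conjC_gt0 //.
by apply: sumr_ge0 => l _; rewrite mul_conjC_ge0.
Qed.

Lemma char_conj (chi : I -> K) e m : fusion_char chi -> chi e != 0 -> (chi (du m))^* = chi m.
Proof.
by move=> hc ce; apply/esym/(mulIf (char_norm_neq0 ce)); apply: char_product.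
Qed.

(** If two characters are not orthogonal, char_product and char_conj force them to agree. *)
Lemma char_orthogonal (chi psi : I -> K) e : fusion_char chi -> fusion_char psi -> psi e != 0 ->
  \sum_l chi l * (psi l)^* != 0 -> chi =1 psi.
Proof.
move=> hc hp pe nz m; apply: (mulIf nz).
by rewrite char_product // (char_conj _ hp pe).
Qed.
End FusionCharacters.

Section ModularData.
Variables (K : numClosedFieldType) (C : premodular K) (I : finType) (J : irrset C I).
Implicit Types (a b c i j k l : I).
Local Notation N := (fusN J).
Local Notation d := (qdim J).
Local Notation th := (theta J).
Local Notation S := (Smx J).
Local Notation "i ^*d" := (dual_idx J i) (at level 2, format "i ^*d").

Lemma Smx_unit i : S i (irr_unit J) = d i.
Proof. by rewrite Smx_hopf hopf_unit pdim_dual. Qed.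

Lemma Smx_mul i j k : S i j * S i k = d i * \sum_l (N j k l)%:R * S i l.
Proof.
rewrite !Smx_hopf hopf_mul pdim_dual; congr (_ * _).
by apply: eq_bigr => l _; rewrite Smx_hopf.
Qed.

(** The Hopf link is symmetric, and dualising all three labels of a fusion coefficient does
    not change it; the dual in the first index of S can thus be moved to the second. *)
Lemma Smx_sym i j : S i j = S j i.
Proof.
rewrite !Smx_hopf [RHS]hopfC !hopfE (reindex_inj (can_inj (dual_idxK J))) /=.
apply: eq_bigr => c _; rewrite !theta_dual pdim_dual.
by rewrite -{1}(dual_idxK J j) fusN_dual.
Qed.

Lemma qdim_char : fusion_char N d.
Proof.
move=> a b; have := ctrace_homtr J (idm (J a ⊗ J b)).
rewrite ctrace_ptrace ptrace_id ctraceZ ctrace_id mulrC => ->.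
by apply: eq_bigr => c _; rewrite homtr_id.
Qed.

Hypothesis mJ : modular J.

(** If the dimension of i vanished, the squares of all entries in row i of S would vanish by
    Smx_mul, contradicting the invertibility of S. *)
Lemma qdim_neq0 i : d i != 0.
Proof.
apply/eqP => di; have S0 j : S i j = 0.
  by apply/eqP; rewrite -sqrf_eq0 expr2 Smx_mul di mul0r.
have h := unitmx_cokernel mJ (v := fun k => (k == i)%:R) _ i.
(* The characteristic function of i is annihilated by S, as row i of S is zero. *)
have {h} /eqP : 1 = 0 :> K.
  have := h; rewrite eqxx; apply => j; rewrite (bigD1 i) //= S0 mulr0 add0r.
  apply: big1 => k /negPf ->.
  by rewrite mul0r.
by rewrite oner_eq0.
Qed.

Lemma qdim_real i : (d i)^* = d i.
Proof.
by rewrite -{1}pdim_dual (char_conj (@fusN_dual_l _ _ _ J) _ qdim_char (qdim_neq0 (irr_unit J))).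
Qed.

Lemma Smx_row_char i : fusion_char N (fun j => S i j / d i).
Proof.
move=> j k; have dn := qdim_neq0 i.
have scale s : d i * s * ((d i)^-1 * (d i)^-1) = s / d i by field.
rewrite mulrACA Smx_mul scale mulr_suml.
by apply: eq_bigr => l _; rewrite -[LHS]mulrA.
Qed.

Lemma Smx_conj i j : (S i j)^* = S i j^*d.
Proof.
have dn := qdim_neq0 i.
have := char_conj (@fusN_dual_l _ _ _ J) (e := irr_unit J) j^*d (Smx_row_char i).
rewrite Smx_unit divff // oner_neq0 dual_idxK => /(_ isT).
rewrite fmorph_div /= qdim_real => /(congr1 (fun t => t * d i)).
by rewrite !mulfVK.
Qed.

(** Rows i and j give characters; were these not orthogonal, they would be equal, and the
    rows of S would be proportional. *)
Lemma Smx_row_orth i j : i != j -> \sum_l S i l * (S j l)^* = 0.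
Proof.
move=> ij; have di := qdim_neq0 i; have dj := qdim_neq0 j.
have e : \sum_l S i l * (S j l)^* =
    d i * d j * \sum_l (S i l / d i) * (S j l / d j)^*.
  rewrite mulr_sumr; apply: eq_bigr => l _; rewrite fmorph_div /= qdim_real.
  by field; rewrite di dj.
rewrite e; apply/eqP; rewrite mulf_eq0; apply/orP; right; apply: contraT => nz.
have p1 : S j (irr_unit J) / d j != 0 by rewrite Smx_unit divff // oner_neq0.
have same := char_orthogonal (@fusN_dual_l _ _ _ J) (Smx_row_char i) (Smx_row_char j) p1 nz.
have := unitmx_cokernel mJ (v := fun k => if k == i then d j else if k == j then - d i else 0)
  _ i; rewrite eqxx => h; have : d j = 0; last by move/eqP: dj.
have ji : (j == i) = false by rewrite eq_sym (negPf ij).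
apply: h => m; rewrite (bigD1 i) //= eqxx (bigD1 j) ?ji //= eqxx.
rewrite big1 => [|k /andP[/negPf -> /negPf ->]]; last by rewrite mul0r.
have /= e' := same m; rewrite addr0 -[S i m](mulfVK di) e' -[S j m in X in _ + X](mulfVK dj).
by move: (S j m / d j) => t; ring.
Qed.

(** Let D be the diagonal matrix of the squared norms of the rows, so that S times its
    conjugate transpose is D. As S is symmetric, bracketing S S^* S in two ways shows that S
    commutes with D; the entries in the unit column are nonzero, so D is scalar, and its
    value is read off from the unit row. *)
Lemma Smx_row_norm i : \sum_l S i l * (S i l)^* = dimC J.
Proof.
pose D i := \sum_l S i l * (S i l)^*; rewrite -/(D i).
have orth a b : \sum_l S a l * (S b l)^* = (a == b)%:R * D a.
  by case: eqVneq => [->|/Smx_row_orth ->]; rewrite ?mul1r ?mul0r.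
have Dreal a : (D a)^* = D a.
  by rewrite rmorph_sum; apply: eq_bigr => l _; rewrite [LHS]rmorphM /= conjCK mulrC.
have DS a b : D a * S a b = S a b * D b.
  transitivity (\sum_m \sum_l S a l * (S m l)^* * S m b).
    under eq_bigr => m _ do rewrite -mulr_suml orth.
    rewrite (bigD1 a) //= eqxx mul1r big1 ?addr0 // => m /negPf.
    by rewrite eq_sym => ->; rewrite !mul0r.
  rewrite exchange_big (bigD1 b) //= [X in _ + X]big1 ?addr0 => [|l lb].
    rewrite -Dreal /D rmorph_sum mulr_sumr; apply: eq_bigr => m _.
    by rewrite [X in _ = _ * X]rmorphM /= conjCK (Smx_sym m b) -mulrA.
  under eq_bigr => m _ do rewrite -mulrA (Smx_sym m b) (Smx_sym m l) [(_)^* * _]mulrC.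
  by rewrite -mulr_sumr orth eq_sym (negPf lb) mul0r mulr0.
have := DS i (irr_unit J); rewrite Smx_unit mulrC => /(mulfI (qdim_neq0 i)) ->.
by apply: eq_bigr => l _; rewrite Smx_sym Smx_unit qdim_real expr2.
Qed.

Lemma dimC_neq0 : dimC J != 0.
Proof.
rewrite -(Smx_row_norm (irr_unit J)).
apply: (char_norm_neq0 (e := irr_unit J)); rewrite Smx_unit; exact: qdim_neq0.
Qed.

(** Inversion of link_sum by the orthogonality of the rows of S. *)
Lemma nu_modular a c :
  dimC J * nu J a c =
  \sum_k \sum_l d k * (S c l)^* * (N k l a)%:R * (th k ^+ 2 / th l ^+ 2).
Proof.
transitivity (\sum_l S c l * \sum_e nu J a e * hopf J e l).
  under eq_bigr => l _ do rewrite mulr_sumr.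
  have hopfS e l : hopf J e l = (S e l)^*.
    by rewrite Smx_sym Smx_conj Smx_sym Smx_hopf dual_idxK.
  rewrite exchange_big (bigD1 c) //= [X in _ + X]big1 ?addr0 => [|e ec].
    by rewrite -(Smx_row_norm c) mulr_suml; apply: eq_bigr => l _; rewrite hopfS; ring.
  under eq_bigr => l _ do rewrite hopfS mulrCA.
  by rewrite -mulr_sumr Smx_row_orth 1?eq_sym // mulr0.
rewrite [RHS]exchange_big [RHS](reindex_inj (can_inj (dual_idxK J))) /=.
apply: eq_bigr => l _; rewrite link_sum mulr_sumr; apply: eq_bigr => k _.
by rewrite Smx_conj dual_idxK theta_dual (fusNC J k) fusN_dual_l; ring.
Qed.
End ModularData.

(** By Smx_mul the expansion of the product of columns a and b in terms of the columns of S
    has the fusion coefficients as coefficients, and the columns are linearly independent. *)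
Lemma fusN_determined (K : numClosedFieldType) (C C' : premodular K) (I : finType)
    (J : irrset C I) (J' : irrset C' I) :
  modular J -> irr_unit J' = irr_unit J -> (forall i j, Smx J' i j = Smx J i j) ->
  forall a b c, fusN J' a b c = fusN J a b c.
Proof.
move=> mJ eu eS a b c; apply/eqP; rewrite -(eqr_nat K) -subr_eq0; apply/eqP.
apply: (unitmx_kernel mJ (v := fun l => (fusN J' a b l)%:R - (fusN J a b l)%:R)) => i.
apply: (mulfI (qdim_neq0 mJ i)); rewrite mulr0.
have := Smx_mul J' i a b; rewrite -(Smx_unit J' i) eu !eS Smx_unit Smx_mul => /eqP.
rewrite -subr_eq0 -mulrBr -sumrB => /eqP e; rewrite -[RHS]oppr0 -[in RHS]e -mulrN -sumrN.
by congr (_ * _); apply: eq_bigr => l _; rewrite eS; ring.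
Qed.

(** * Eigenbases of the braiding *)

Section Bases.
Variable K : fieldType.

(** The two bases have the same length only propositionally, since they are bases of
    different spaces. *)
Lemma mx_of_scale (U V : vectType K) n m (e : n.-tuple U) (e' : m.-tuple V) (k : K) (f : U -> V) :
  m = n -> basis_of fullv e' -> (forall j : 'I_n, f e`_j = k *: e'`_j) ->
  eqmx_cast (mx_of e e' f) (k *: 1%:M : 'M[K]_m).
Proof.
move=> mn; move: mn e => <- e be fe; exists (erefl, erefl); apply/matrixP => i j.
by rewrite castmxE !mxE /= !cast_ord_id fe linearZ /= coord_free ?(basis_free be) // eq_sym.
Qed.

(** Every v is the sum of (v + f v / mu) / 2 and (v - f v / mu) / 2, which are eigenvectors
    for mu and - mu. *)
Lemma square_root_basis (V : vectType K) (mu : K) (f : V -> V) :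
  (2 : K) != 0 -> mu != 0 -> linear f -> (forall v, f (f v) = mu ^+ 2 *: v) ->
  exists p m (e : (p + m).-tuple V), basis_of fullv e /\
    mx_of e e f = mu *: block_mx (1%:M : 'M[K]_p) 0 0 (- 1%:M : 'M[K]_m).
Proof.
move=> two mu0 lf ff.
(* The eigenspace for s is the kernel of g s. *)
pose g (s : K) (v : V) := f v - s *: v.
have lg s : linear (g s).
  by move=> a u v; rewrite /g lf scalerDr scalerBr opprD !scalerA [a * s]mulrC addrACA.
pose E s := lker (linfun (linear_map (lg s))).
have EP s v : (v \in E s) = (f v == s *: v).
  by rewrite memv_ker lfunE /= subr_eq0.
have dir : directv (E mu + E (- mu)).
  apply/directv_addP/eqP; rewrite -subv0; apply/subvP => v.
  rewrite memv_cap !EP memv0 => /andP[/eqP-> ]; rewrite scaleNr -addr_eq0 -scalerDl scaler_eq0.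
  by rewrite -mulr2n -mulr_natl mulf_eq0 (negPf two) (negPf mu0).
have full : (E mu + E (- mu))%VS = fullv.
  apply/eqP; rewrite eqEsubv subvf; apply/subvP => v _.
  have -> : v = (2 * mu)^-1 *: (mu *: v + f v) + (2 * mu)^-1 *: (mu *: v - f v).
    rewrite -scalerDr addrACA subrr addr0 -scalerDl scalerA -mulr2n -(mulr_natl mu 2).
    by rewrite mulVf ?scale1r // mulf_neq0.
  have fE s : f (mu *: v + s *: f v) = mu *: f v + (s * mu ^+ 2) *: v.
    by rewrite lf (linZ lf) ff scalerA.
  rewrite memv_add // memvZ // EP.
    by rewrite -[X in mu *: v + X]scale1r fE scalerDr scalerA mul1r addrC scale1r.
  rewrite -(scaleN1r (f v)) fE scalerDr !scalerA mulN1r mulrN1 opprK addrC.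
  by rewrite mulNr -expr2.
pose e := [tuple of vbasis (E mu) ++ vbasis (E (- mu))].
exists (\dim (E mu)), (\dim (E (- mu))), e.
have be : basis_of fullv e by rewrite -full; apply: cat_basis => //; apply: vbasisP.
split=> //.
have fe j : f e`_j = (if (j < \dim (E mu))%N then mu else - mu) *: e`_j.
  rewrite nth_cat size_tuple; case: ltnP => hj; apply/eqP; rewrite -EP.
    by apply: vbasis_mem; apply: mem_nth; rewrite size_tuple.
  case: (ltnP (j - \dim (E mu)) (\dim (E (- mu)))) => hj'.
    by apply: vbasis_mem; apply: mem_nth; rewrite size_tuple.
  by rewrite nth_default ?size_tuple // mem0v.
apply/matrixP => i j; rewrite [LHS]mxE [RHS]mxE fe linearZ /= coord_free ?(basis_free be) //.
rewrite -(splitK j) -(splitK i); case: (split j) => j'; case: (split i) => i' /=;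
  rewrite ?(block_mxEul, block_mxEur, block_mxEdl, block_mxEdr) !mxE
    ?(eq_lshift, eq_rshift, eq_lrshift, eq_rlshift) ?ltn_ord ?[(_ + _ < _)%N]ltnNge ?leq_addr /=.
- by rewrite eq_sym.
- by rewrite !mulr0.
- by rewrite !mulr0.
- by rewrite eq_sym mulrN mulNr.
Qed.
End Bases.

Section Eigenbasis.
Variables (K : numClosedFieldType) (C : premodular K) (I : finType) (J : irrset C I).
Variable sq : I -> K.
Hypothesis hsq : forall c, sq c ^+ 2 = theta J c.
Local Notation N := (fusN J).

Lemma sq_neq0 c : sq c != 0.
Proof. by rewrite -sqrf_eq0 hsq theta_neq0. Qed.

Lemma Rmap_linear a b c : linear (@Rmap K C I J a b c).
Proof. exact: compm_linear_l. Qed.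

Lemma Rmap_twice a b c (q : hom (J a ⊗ J b) (J c)) :
  Rmap (Rmap q) = (theta J c / (theta J a * theta J b)) *: q.
Proof. by rewrite /Rmap -compmA -/(dbraid (J a) (J b)) dbraid_hom. Qed.

Lemma Rmap_basis a b c (X : seq (hom (J b ⊗ J a) (J c))) :
  basis_of fullv X -> basis_of fullv (map (@Rmap K C I J a b c) X).
Proof.
move=> bX; pose f := linfun (linear_map (@Rmap_linear a b c)).
have fE : f =1 @Rmap K C I J a b c by move=> v; rewrite lfunE.
have [bK bVK] := braid_iso (J a) (J b).
have img : (f @: fullv = fullv)%VS.
  apply/eqP; rewrite eqEsubv subvf; apply/subvP => v _; apply/memv_imgP.
  by exists (v ∘ braidV (J a) (J b)); rewrite ?memvf // fE /Rmap -compmA bK compm_idr.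
rewrite -(eq_map fE) -img; apply: limg_basis_of bX.
apply/eqP; rewrite -subv0; apply/subvP => v; rewrite memv_cap memvf memv_ker fE memv0 /=.
by move=> /eqP e; rewrite -[v]compm_idr -bVK compmA -/(Rmap v) e comp0m.
Qed.

(** The difference of the multiplicities is the trace of Rmap divided by its eigenvalue,
    which is the indicator up to the square root of theta. *)
Lemma braid_eigenbasis a c : exists p m (e : (p + m).-tuple (hom (J a ⊗ J a) (J c))),
  [/\ basis_of fullv e,
      mx_of e e (@Rmap K C I J a a c) =
        (sq c / theta J a) *: block_mx (1%:M : 'M[K]_p) 0 0 (- 1%:M : 'M[K]_m),
      N a a c = (p + m)%N & p%:R - m%:R = (sq c)^-1 * nu J a c].
Proof.
have an := theta_neq0 J a; have sn := sq_neq0 c.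
have mu0 : sq c / theta J a != 0 by rewrite mulf_neq0 // invr_eq0.
have [] := @square_root_basis K _ (sq c / theta J a) (@Rmap K C I J a a c) _ mu0
  (@Rmap_linear a a c).
- by rewrite pnatr_eq0.
- by move=> v; rewrite Rmap_twice expr_div_n hsq expr2.
move=> p [m [e [be me]]]; exists p, m, e; split=> //.
  by rewrite /fusN -(size_basis be).
rewrite nu_homtr /homtr (trace_basis be (@Rmap_linear a a c)) me.
rewrite mxtraceZ mxtrace_block raddfN /= !mxtrace1.
by field; rewrite sn an.
Qed.

(** The sum and the difference of the multiplicities determine both. *)
Lemma eigen_multiplicities a c :
  exists p m : nat, [/\ N a a c = (p + m)%N, (sq c)^-1 * nu J a c = p%:R - m%:R,
    p%:R = 2^-1 * ((N a a c)%:R + (sq c)^-1 * nu J a c)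
    & m%:R = 2^-1 * ((N a a c)%:R - (sq c)^-1 * nu J a c)].
Proof.
have [p [m [e [_ _ Npm nupm]]]] := braid_eigenbasis a c.
by exists p, m; split; rewrite -?nupm ?Npm ?natrD //; field.
Qed.
End Eigenbasis.

Section Gauge.
Variables (K : numClosedFieldType) (C : premodular K).
Variables (disp : Order.disp_t) (I : finOrderType disp) (J : irrset C I).
Variable sq : I -> K.
Hypothesis hsq : forall c, sq c ^+ 2 = theta J c.
Local Notation N := (fusN J).

(** For a = b take an eigenbasis of the braiding; for a < b any basis will do, and for a > b
    its image under the braiding. *)
Lemma gauge_exists (dp dm : I -> I -> nat) :
  (forall a c, (dp a c)%:R = 2^-1 * ((N a a c)%:R + (sq c)^-1 * nu J a c) /\
     (dm a c)%:R = 2^-1 * ((N a a c)%:R - (sq c)^-1 * nu J a c)) ->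
  exists B : gauge J, is_gauge B /\ braiding_form sq dp dm B.
Proof.
move=> hdpm.
have diag a c : exists D : (N a a c).-tuple (hom (J a ⊗ J a) (J c)), basis_of fullv D /\
  eqmx_cast (mx_of D D (@Rmap K C I J a a c)) ((sq c / theta J a) *:
      block_mx (1%:M : 'M[K]_(dp a c)) 0 0 (- 1%:M : 'M[K]_(dm a c))).
  have [p [m [e [be me Npm nupm]]]]   := braid_eigenbasis hsq a c.
  have [hp hm] := hdpm a c.
  have -> : dp a c = p.
    by apply/eqP; rewrite -(eqr_nat K) hp -nupm Npm natrD; apply/eqP; field.
  have -> : dm a c = m.
    by apply/eqP; rewrite -(eqr_nat K) hm -nupm Npm natrD; apply/eqP; field.
  exists (tcast (esym Npm) e); split.
    by rewrite /basis_of val_tcast.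
  case: _ / (esym Npm); exists (erefl, erefl).
  by rewrite -me; apply/matrixP => i j; rewrite castmxE !cast_ord_id.
pose D a c := sval (cid (diag a c)); have DP a c := svalP (cid (diag a c)).
have [B BP] : exists B : gauge J, forall a b c,
    [/\ forall e : a = b,
          eq_rect a (fun b => (N a b c).-tuple (hom (J a ⊗ J b) (J c))) (D a c) b e = B a b c,
        (a < b)%O -> B a b c = vbasis {:hom (J a ⊗ J b) (J c)} :> seq _
      & (b < a)%O -> B a b c =
          map (@Rmap _ _ _ J a b c) (vbasis {:hom (J b ⊗ J a) (J c)}) :> seq _].
  (* The condition for a = b is transported along the equality, so that it can be stated for all
     pairs at once. *)
  have loc a b c : exists t : (N a b c).-tuple (hom (J a ⊗ J b) (J c)),
    [/\ forall e : a = b,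
          eq_rect a (fun b => (N a b c).-tuple (hom (J a ⊗ J b) (J c))) (D a c) b e = t,
        (a < b)%O -> t = vbasis {:hom (J a ⊗ J b) (J c)} :> seq _
      & (b < a)%O -> t =
          map (@Rmap _ _ _ J a b c) (vbasis {:hom (J b ⊗ J a) (J c)}) :> seq _].
    case: (ltgtP a b) => [ab|ba|e].
    - exists (vbasis {:hom (J a ⊗ J b) (J c)}); split=> // e.
      by exfalso; move: ab; rewrite e ltxx.
    - exists (tcast (fusNC J b a c)
        (map_tuple (@Rmap _ _ _ J a b c) (vbasis {:hom (J b ⊗ J a) (J c)}))).
      split=> // [e|_]; last by rewrite val_tcast.
      by exfalso; move: ba; rewrite e ltxx.
    - case: b / e; exists (D a c); split=> [e||]; rewrite ?ltxx //.
      by rewrite (Prop_irrelevance e erefl).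
  by exists (fun a b c => sval (cid (loc a b c))) => a b c; exact: (svalP (cid (loc a b c))).
have Beq a c : B a a c = D a c by have [<-] := BP a a c.
have Blt a b c : (a < b)%O -> B a b c = vbasis {:hom (J a ⊗ J b) (J c)} :> seq _.
  by have [_ h _] := BP a b c.
have Bgt a b c : (b < a)%O -> B a b c = map (@Rmap _ _ _ J a b c) (B b a c) :> seq _.
  by move=> ba; have [_ _ ->//] := BP a b c; rewrite (Blt b a).
have Bbasis a b c : basis_of fullv (B a b c).
  case: (ltgtP a b) => [ab|ba|<-]; last by rewrite Beq; have [] := DP a c.
    by rewrite Blt //; apply: vbasisP.
  rewrite Bgt // Blt //.
  exact: Rmap_basis (vbasisP _).
exists B; split; first exact: Bbasis.
have nthR a b c j : (b < a)%O -> (j < N b a c)%N -> Rmap (B b a c)`_j = (B a b c)`_j.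
  by move=> ba hj; rewrite (Bgt a b c) // (nth_map 0) // size_tuple.
split=> [a b c ba|a b c ab|a c].
- have := mx_of_scale (e := B b a c) (k := 1) (f := @Rmap _ _ _ J a b c)
    (fusNC J a b c) (Bbasis a b c).
  by rewrite scale1r; apply => j; rewrite scale1r nthR.
- apply: mx_of_scale => [||j]; [exact: fusNC | exact: Bbasis |].
  by rewrite -(nthR b a c j ab) ?(fusNC J a b c) // Rmap_twice.
- by have [_] := DP a c; rewrite /Rmx Beq.
Qed.
End Gauge.

(** * The theorem *)

Lemma nu_modular_normalised (K : numClosedFieldType) (C : premodular K) (I : finType)
    (J : irrset C I) (a c : I) (s : K) : modular J ->
  (s * dimC J)^-1 * (\sum_k \sum_l qdim J k * (Smx J c l)^* * (fusN J k l a)%:R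
     * (theta J k ^+ 2 / theta J l ^+ 2)) = s^-1 * nu J a c.
Proof. by move=> mJ; rewrite -(nu_modular mJ) invfM -mulrA mulKf ?dimC_neq0. Qed.

Theorem theorem3p1 (R : realType) (C : premodular R[i])
    (disp : Order.disp_t) (I : finOrderType disp) (J : irrset C I)
    (sq : I -> R[i]) (hsq : forall c, sq c ^+ 2 = theta J c) :
  (forall a c : I, exists n : int,
      [/\ (sq c)^-1 * nu J a c = n%:~R,
          `|(sq c)^-1 * nu J a c| <= (fusN J a a c)%:R
        & (n = (fusN J a a c)%:Z %[mod 2])%Z]) /\
  exists dp dm : I -> I -> nat,
    [/\ forall a c : I,
          (dp a c)%:R = 2^-1 * ((fusN J a a c)%:R + (sq c)^-1 * nu J a c) /\
          (dm a c)%:R = 2^-1 * ((fusN J a a c)%:R - (sq c)^-1 * nu J a c),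
        exists B : gauge J, is_gauge B /\ braiding_form sq dp dm B
      & modular J ->
        [/\ forall (C' : premodular R[i]) (J' : irrset C' I),
              irr_unit J' = irr_unit J ->
              (forall i j, Smx J' i j = Smx J i j) ->
              forall a b c, fusN J' a b c = fusN J a b c,
            forall (C' : premodular R[i]) (J' : irrset C' I),
              irr_unit J' = irr_unit J ->
              (forall i j, Smx J' i j = Smx J i j) ->
              (forall i j, Tmx J' i j = Tmx J i j) ->
              exists B' : gauge J', is_gauge B' /\ braiding_form sq dp dm B'
          & forall a c : I,
              let X := (sq c * dimC J)^-1 *
                \sum_k \sum_l qdim J k * (Smx J c l)^* * (fusN J k l a)%:R
                              * (theta J k ^+ 2 / theta J l ^+ 2) in
              (dp a c)%:R = 2^-1 * ((fusN J a a c)%:R + X) /\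
              (dm a c)%:R = 2^-1 * ((fusN J a a c)%:R - X)]].
Proof.
pose mult a c := cid (eigen_multiplicities hsq a c).
pose dp a c := sval (mult a c); pose dm a c := sval (cid (svalP (mult a c))).
have H a c : [/\ fusN J a a c = (dp a c + dm a c)%N,
    (sq c)^-1 * nu J a c = (dp a c)%:R - (dm a c)%:R,
    (dp a c)%:R = 2^-1 * ((fusN J a a c)%:R + (sq c)^-1 * nu J a c)
    & (dm a c)%:R = 2^-1 * ((fusN J a a c)%:R - (sq c)^-1 * nu J a c)].
  exact: (svalP (cid (svalP (mult a c)))).
split=> [a c|].
  have [hN hnu _ _] := H a c; exists ((dp a c)%:Z - (dm a c)%:Z); rewrite hN hnu; split.
  - by rewrite rmorphB /= !pmulrn.
  - rewrite natrD; apply: le_trans (ler_normB _ _) _; by rewrite !normr_nat.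
  - lia.
exists dp, dm; split=> [a c||mJ].
- by have [_ _ hp hm] := H a c.
- by apply: (gauge_exists hsq) => a c; have [_ _ hp hm] := H a c.
split.
- move=> C' J' eu eS; exact: (fusN_determined mJ eu eS).
- move=> C' J' eu eS eT.
  have eN := fusN_determined mJ eu eS.
  have et c : theta J' c = theta J c by have := eT c c; rewrite /Tmx eqxx !mul1r.
  have mJ' : modular J' by rewrite /modular; under eq_mx do rewrite eS.
  have ed c : qdim J' c = qdim J c by rewrite -(Smx_unit J') eu eS Smx_unit.
  have hsq' c : sq c ^+ 2 = theta J' c by rewrite et hsq.
  have enu a c : (sq c)^-1 * nu J' a c = (sq c)^-1 * nu J a c.
    rewrite -(nu_modular_normalised _ _ _ mJ') -(nu_modular_normalised _ _ _ mJ).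
    congr ((_ * _)^-1 * _).
      by rewrite /dimC; apply: eq_bigr => k _; rewrite ed.
    by apply: eq_bigr => k _; apply: eq_bigr => l _; rewrite ed eS eN !et.
  apply: (gauge_exists hsq') => a c; rewrite eN enu.
  by have [_ _ hp hm] := H a c.
- move=> a c; rewrite /= (nu_modular_normalised _ _ _ mJ).
  by have [_ _ hp hm] := H a c.
Qed.
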